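(* Let $k\ge 2$ be an integer. As formal power series in the commuting indeterminates $a_1,a_2,a_3,\dots$ (with rational coefficients, graded by $\deg a_i=i$), $$1+\sum_{n \geq 1}\ \sum_{w \in S_{n+1}} \frac{1}{(n+1)k^{n+1}} \binom{n+k-cd(w)}{n} \prod_{i\ge 1} a_i^{n_i(w)} = 1-\frac{1}{k-1} -\frac{a_1}{k} + \frac{1}{k-1} \prod_{i \geq 1} \left(1-\frac{a_i}{k^i}\right)^{-\frac1i \sum_{d\mid i} \mu(d) (k^{i/d}-1)}.$$ Moreover, if $k=q$ is the size of a finite field $F_q$, then for every $n\ge 1$ the cycle type of a permutation in $S_n$ distributed as a $q$-riffle shuffle followed by a cut has the same law as the factorization type of a uniformly chosen monic degree $n$ polynomial over $F_q$ with non-vanishing constant term. That is, for all nonnegative integers $(n_i)_{i\ge1}$ with $\sum_i i\,n_i=n$, the probability that the permutation has exactly $n_i$ cycles of length $i$ for every $i$ equals the probability that a uniformly chosen monic degree $n$ polynomial over $F_q$ with non-zero constant term factors into exactly $n_i$ irreducible monic polynomials of degree $i$ (counted with multiplicity) for every $i$.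
   Context: $S_m$ is the symmetric group on $\{1,\dots,m\}$. $\mu$ is the Moebius function of elementary number theory. $n_i(w)$ is the number of $i$-cycles of the permutation $w$ (fixed points are $1$-cycles). For $w\in S_m$, $w$ has a descent at position $i$ ($1\le i\le m-1$) if $w(i)>w(i+1)$, and a cyclic descent at position $m$ if $w(m)>w(1)$. Let $d(w)$ be the number of descents of $w$, and let $cd(w)=d(w)$ if $w$ has no cyclic descent at $m$ and $cd(w)=d(w)+1$ if $w$ has a cyclic descent at $m$. $k$-riffle shuffle of $n$ cards: cut the deck into $k$ piles, of sizes $j_1,\dots,j_k$ with probability $\binom{n}{j_1,\dots,j_k}/k^n$; then drop cards one at a time from the piles, so that if the current pile sizes are $A_1,\dots,A_k$, the next card is dropped from pile $i$ with probability $A_i/(A_1+\cdots+A_k)$. ''Followed by a cut'' means followed by a cut (cyclic rotation of the deck) at a uniformly chosen position. It is known that the chance of obtaining $w\in S_n$ after a $k$-riffle shuffle followed by a cut is $$\frac{1}{nk^{n-1}} \binom{n+k-cd(w^{-1})-1}{n-1},$$ and this formula may be taken as the definition of the distribution. *)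

(* Defs.v *)
From HB Require Import structures.
From mathcomp Require Import all_boot all_order all_algebra all_fingroup.
From mathcomp Require Import finmap multiset.
From mathcomp Require Import boolp.

Set Implicit Arguments.
Unset Strict Implicit.
Unset Printing Implicit Defensive.

Import GRing.Theory.
Local Open Scope ring_scope.

(* A monomial in a_1, a_2, ... is a finite multiset of naturals: the exponent
   of a_(j.+1) in [m] is the multiplicity [m j]. *)
Notation monomial := {mset nat}%mset.

Definition weight (m : monomial) : nat :=
  (\sum_(j <- finsupp m) j.+1 * m j)%N.

Definition mdivisors (m : monomial) : seq monomial :=
  undup [seq (seq_mset (mask b m) : monomial) | b : (size m).-tuple bool].

Lemma mem_mdivisors (m x : monomial) : (x \in mdivisors m) = (x `<=` m)%mset.
Proof.
rewrite mem_undup; apply/mapP/msubsetP => [[b _ ->] i|le_xm].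
  rewrite mset_seqE -[leqRHS]count_mem_mset.
  exact/leq_count_subseq/mask_subseq.
have /count_subseqP[s /subseqP[b sb ->] eq_x] :
    forall i, (count_mem i x <= count_mem i m)%N.
  by move=> i; rewrite !count_mem_mset.
have sb' : size b == size m by apply/eqP.
exists (Tuple sb'); first by rewrite mem_enum.
by rewrite /= -(seq_mset_id x); apply/eq_seq_msetP.
Qed.

Definition fps := monomial -> rat.

HB.instance Definition _ := gen_eqMixin fps.
HB.instance Definition _ := gen_choiceMixin fps.

Section FpsRing.
Implicit Types (f g h : fps) (m : monomial).

Definition fps_add f g : fps := fun m => f m + g m.
Definition fps_opp f : fps := fun m => - f m.
Definition fps_mul f g : fps :=
  fun m => \sum_(x <- mdivisors m) f x * g (m `\` x)%mset.
Definition fps_one : fps := fun m => (m == mset0)%:R.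
Definition fps_scale (c : rat) f : fps := fun m => c * f m.

Lemma fps_addA : associative fps_add.
Proof. by move=> f g h; apply/funext => m; rewrite /fps_add addrA. Qed.
Lemma fps_addC : commutative fps_add.
Proof. by move=> f g; apply/funext => m; rewrite /fps_add addrC. Qed.
Lemma fps_add0 : left_id (fun=> 0 : rat) fps_add.
Proof. by move=> f; apply/funext => m; rewrite /fps_add add0r. Qed.
Lemma fps_addN : left_inverse (fun=> 0 : rat) fps_opp fps_add.
Proof. by move=> f; apply/funext => m; rewrite /fps_add addNr. Qed.

HB.instance Definition _ :=
  GRing.isZmodule.Build fps fps_addA fps_addC fps_add0 fps_addN.

Lemma mdivisors_uniq m : uniq (mdivisors m).
Proof. exact: undup_uniq. Qed.

Lemma fps_mulC : commutative fps_mul.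
Proof.
move=> f g; apply/funext => m; rewrite /fps_mul.
have sub_inj : {in mdivisors m &, injective (fun x => (m `\` x)%mset)}.
  move=> x y; rewrite !mem_mdivisors => xm ym eqxy.
  by rewrite -(msetBBK xm) eqxy msetBBK.
rewrite [RHS](perm_big [seq (m `\` x)%mset | x <- mdivisors m]) /=.
  rewrite big_map !big_seq; apply: eq_bigr => x.
  by rewrite mem_mdivisors => xm; rewrite msetBBK // mulrC.
apply: uniq_perm => [||y]; first exact: mdivisors_uniq.
  by rewrite (map_inj_in_uniq sub_inj) mdivisors_uniq.
rewrite mem_mdivisors; apply/idP/mapP => [ym|[x _ ->]].
  exists (m `\` y)%mset; last by rewrite msetBBK.
  by rewrite mem_mdivisors; apply/msubsetP=> i; rewrite msetE2 leq_subr.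
by apply/msubsetP=> i; rewrite msetE2 leq_subr.
Qed.

Lemma fps_mulA : associative fps_mul.
Proof.
move=> f g h; apply/funext => m; rewrite /fps_mul.
pose F (t : monomial * monomial) :=
  f t.1 * g t.2 * h ((m `\` t.1) `\` t.2)%mset.
transitivity (\sum_(t <- [seq (x, y) | x <- mdivisors m,
    y <- mdivisors (m `\` x)%mset]) F t).
  rewrite big_allpairs_dep; apply: eq_bigr => x _.
  by rewrite mulr_sumr; apply: eq_bigr => y _; rewrite mulrA.
transitivity (\sum_(t <- [seq (x, z `\` x)%mset | z <- mdivisors m,
    x <- mdivisors z]) F t); last first.
  rewrite big_allpairs_dep; apply: eq_big_seq => z zm.
  rewrite mulr_suml; apply: eq_big_seq => x; rewrite mem_mdivisors => xz.
  rewrite /F /= -msetBDA msetBDKC //.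
apply: perm_big; apply: uniq_perm.
- apply: allpairs_uniq_dep;
    [exact: mdivisors_uniq|by move=> x _; exact: mdivisors_uniq|].
  by move=> [x y] [x' y'] _ _ /= [-> ->].
- apply: allpairs_uniq_dep;
    [exact: mdivisors_uniq|by move=> x _; exact: mdivisors_uniq|].
  move=> _ _ /allpairsPdep[z [x [_ + ->]]] /allpairsPdep[z' [x' [_ + ->]]] /=.
  rewrite !mem_mdivisors => xz xz' [eqx eqz].
  have -> : z = z' by rewrite -(msetBDKC xz) -(msetBDKC xz') -eqz -eqx.
  by rewrite eqx.
move=> [x y]; apply/allpairsPdep/allpairsPdep.
  move=> [x0 [y0 [xm ym [-> ->]]]]; move: xm ym {x y}.
  rewrite !mem_mdivisors => xm ym.
  exists (x0 `+` y0)%mset, x0; rewrite !mem_mdivisors msetDKB; split => //.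
  by rewrite -(msetBDKC xm) msetDS.
  by apply/msubsetP => i; rewrite msetE2 leq_addr.
move=> [z [x0 [zm xz [-> ->]]]]; move: zm xz.
rewrite !mem_mdivisors => zm xz.
exists x0, (z `\` x0)%mset; rewrite !mem_mdivisors; split => //.
- exact: msubset_trans xz zm.
- exact: msetSB.
Qed.

Lemma fps_mul1 : left_id fps_one fps_mul.
Proof.
move=> f; apply/funext => m; rewrite /fps_mul.
rewrite (bigD1_seq mset0) ?mdivisors_uniq ?mem_mdivisors ?msub0set //=.
rewrite /fps_one eqxx mul1r msetB0 big1 ?addr0 // => x /negPf->.
by rewrite mul0r.
Qed.

Lemma fps_mulDl : left_distributive fps_mul fps_add.
Proof.
move=> f g h; apply/funext => m; rewrite /fps_mul /fps_add -big_split /=.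
by apply: eq_bigr => x _; rewrite mulrDl.
Qed.

Lemma fps_one_neq0 : fps_one != 0.
Proof.
apply/eqP => /(congr1 (fun f : fps => f mset0)); rewrite /fps_one eqxx.
by move/eqP; rewrite oner_eq0.
Qed.

HB.instance Definition _ := GRing.Zmodule_isComNzRing.Build fps
  fps_mulA fps_mulC fps_mul1 fps_mulDl fps_one_neq0.

Lemma fps_scaleA c d f : fps_scale c (fps_scale d f) = fps_scale (c * d) f.
Proof. by apply/funext => m; rewrite /fps_scale mulrA. Qed.
Lemma fps_scale1 : left_id 1 fps_scale.
Proof. by move=> f; apply/funext => m; rewrite /fps_scale mul1r. Qed.
Lemma fps_scaleDr : right_distributive fps_scale +%R.
Proof. by move=> c f g; apply/funext => m; rewrite /fps_scale mulrDr. Qed.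
Lemma fps_scaleDl f : {morph fps_scale^~ f : c d / c + d}.
Proof. by move=> c d; apply/funext => m; rewrite /fps_scale mulrDl. Qed.

HB.instance Definition _ := GRing.Zmodule_isLmodule.Build rat fps
  fps_scaleA fps_scale1 fps_scaleDr fps_scaleDl.

Lemma fps_scaleAl (c : rat) f g : c *: (f * g) = (c *: f) * g.
Proof.
apply/funext => m; rewrite /GRing.scale /GRing.mul /= /fps_scale /fps_mul.
by rewrite mulr_sumr; apply: eq_bigr => x _; rewrite mulrA.
Qed.

HB.instance Definition _ := GRing.Lmodule_isLalgebra.Build rat fps fps_scaleAl.

End FpsRing.

(* Only meant for i >= 1. *)
Definition indet (i : nat) : fps :=
  fun m => (m == [mset i.-1]%mset :> monomial)%:R.

(* Convergence for the grading deg a_i = i: each homogeneous component is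
   eventually constant. *)
Definition fps_lim (u : nat -> fps) (l : fps) : Prop :=
  forall d, exists N, forall n m,
    (N <= n)%N -> weight m = d -> u n m = l m.

Lemma fps_lim_unique u l l' : fps_lim u l -> fps_lim u l' -> l = l'.
Proof.
move=> ul ul'; apply/funext => m.
have [N uN] := ul (weight m); have [N' uN'] := ul' (weight m).
by rewrite -(uN (maxn N N')) ?leq_maxl // (uN' (maxn N N')) ?leq_maxr.
Qed.

Definition gbinom (c : rat) (j : nat) : rat :=
  (\prod_(l < j) (c - l%:R)) / (j`!)%:R.

(* For [g] with constant term 1, the power g^c given by the binomial series
   \sum_j binom(c, j) (g - 1)^j; the terms with j > weight m do not contribute
   to the coefficient of m. *)
Definition fps_powr (g : fps) (c : rat) : fps :=
  fun m => \sum_(j < (weight m).+1) gbinom c j * ((g - 1) ^+ j) m.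

(* The value at 0 is irrelevant. *)
Definition moebius (n : nat) : int :=
  if all (fun p => logn p n == 1)%N (primes n)
  then (-1) ^+ size (primes n) else 0.

Section Permutations.
Variable m : nat.
Implicit Type w : 'S_m.

Definition ncycles (i : nat) w : nat := #|[set C in porbits w | #|C| == i]|.

(* Positions are counted from 0. *)
Definition descent_at w (i : 'I_m) : bool :=
  [exists j : 'I_m, (val j == i.+1) && (w j < w i)%N].

Definition cyclic_descent w : bool :=
  [exists i : 'I_m, exists j : 'I_m,
     [&& i.+1 == m, val j == 0%N & (w j < w i)%N]].

Definition des w : nat := #|[set i | descent_at w i]|.

Definition cdes w : nat := if cyclic_descent w then (des w).+1 else des w.

(* The law of a k-riffle shuffle of m cards followed by a cut. *)
Definition riffle_cut_prob (k : nat) w : rat :=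
  (m%:R * k%:R ^+ (m - 1)%N)^-1 * 'C(m + k - cdes (w^-1)%g - 1, m - 1)%N%:R.

End Permutations.

Section Polynomials.
Variable F : finFieldType.

Definition monic_nz_polys (n : nat) : {set {poly_n.+1 F}} :=
  [set p : {poly_n.+1 F} |
    [&& (p : {poly F}) \is monic, size p == n.+1 & p`_0 != 0]].

Definition factors_as (c : nat -> nat) (p : {poly F}) : Prop :=
  exists s : seq {poly F},
    [/\ forall f, f \in s -> f \is monic /\ irreducible_poly f,
        p = \prod_(f <- s) f
      & forall i, (0 < i)%N -> count (fun f : {poly F} => size f == i.+1) s = c i].

End Polynomials.

(* Main.v *)
Require Import Defs.
From mathcomp Require Import all_boot all_order all_algebra all_fingroup.
From mathcomp Require Import finmap multiset.
From mathcomp Require Import boolp.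
From mathcomp Require Import zify ring.

Set Implicit Arguments.
Unset Strict Implicit.
Unset Printing Implicit Defensive.

Import Order.TTheory GRing.Theory Num.Theory.
Local Open Scope ring_scope.

(** Why the theorem is true.

Both halves follow from one identity, [cyclic_descent_cycle_type]. For a cycle
type [c] of weight [n], with [c i] cycles of length [i],

  [(k - 1) * sum over w of type c of C(n + k - 1 - cdes w, n - 1)
     = n * product over i of C(M i + c i - 1, c i)],

where [M i = 1/i * sum over d | i of mu(d) (k^(i/d) - 1)] is the number of
primitive necklaces of length [i] on [k] letters, one of the [k] necklaces of
length [1] being left out.

This identity is deduced from the theorem of Gessel and Reutenauer,
[gessel_reutenauer], which has ordinary descents, [C(n + k - 1 - des w, n)], and
all the primitive necklaces. The binomial coefficient counts the weakly
increasing words [s] on [k] letters that increase strictly at the descents of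
[w] ([card_compatible]). Reading [s] along the cycles of [w] gives a multiset of
necklaces with the cycle type of [w]. The permutation [w] increases on each set
of positions from which the same word is read, and an increasing self-map of a
finite chain is the identity: this one remark shows that the necklaces are
primitive ([itinerary_inj_orbit]) and that the multiset determines [w] and [s]
([compatible_determined]). Every multiset is obtained because both sides have
[k^n] elements when all cycle types are allowed: sorting a word stably yields a
pair [(w, s)], while the multisets are counted by the recurrence
[multisets_recurrence], which expresses the logarithmic derivative of an Euler
product.

To reach cyclic descents, conjugate [w] by the [n] rotations. The cycle type and
[cdes] do not change, and exactly [cdes w - 1 + ncycles 1 w] of the conjugates
have a cyclic descent at the last position ([sum_cyclic_descent]); the others
have [des] equal to [cdes]. Summing over the conjugates gives

  [n * sum of C(n + k - 1 - des w, n)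
     = (k - 1 + c 1) * sum of C(n + k - 1 - cdes w, n - 1)],

and the factor [k - 1 + c 1] replaces [k] by [k - 1] in the binomial coefficient
for the fixed points.

The generating function identity compares the coefficients of each monomial: in
weight at least [2] it is the identity above, and the weights [0] and [1] are
the correction terms. For polynomials, the monic ones of degree [n] are the
multisets of monic irreducibles of total degree [n] and there are [q^n] of them;
running the same recurrence backwards and applying Moebius inversion counts the
irreducibles of each degree. Without [X] there are [M i] of degree [i], so the
polynomials of type [c] are counted by the product in the identity. *)

(** * Multisets of weighted objects *)

Section WeightedMultisets.
Local Open Scope nat_scope.
Variables (T : finType) (N : nat) (P : pred T) (wt : T -> nat).
Implicit Types (x : T) (f : {ffun T -> 'I_N.+1}).

(** A multiset is encoded by its multiplicity function, bounded by a fixed [N]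
    to stay in a finite type; the bound is harmless for total weights up to
    [N]. Multiplicities vanish off [P], so that one ambient type can serve for
    several families of objects. *)
Definition multisets n : {set {ffun T -> 'I_N.+1}} :=
  [set f : {ffun T -> 'I_N.+1} | [forall x, P x || (f x == ord0)]
           && (\sum_(x | P x) wt x * f x == n)].

Lemma multisetsP n f :
  reflect ((forall x, ~~ P x -> f x = ord0) /\ \sum_(x | P x) wt x * f x = n)
          (f \in multisets n).
Proof.
rewrite inE; apply: (iffP andP) => [[/forallP h /eqP->]|[h ->]]; split=> //.
  by move=> x nPx; have := h x; rewrite (negPf nPx) => /eqP.
by apply/forallP => x; case: (boolP (P x)) => //= /h ->.
Qed.

(** The power sum attached to the family: in the Euler product of the weight
    series, this is the coefficient of [z^j] in [z] times the logarithmic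
    derivative. *)
Definition weight_divisor_sum j := \sum_(x | P x && (wt x %| j)) wt x.

Hypothesis wt_gt0 : forall x, P x -> 0 < wt x.

Lemma multisets_le n f x : f \in multisets n -> P x -> wt x * f x <= n.
Proof. by move=> /multisetsP[_ <-] Px; rewrite (bigD1 x) //= leq_addr. Qed.

(** Removing [r] copies of [x] is a bijection; its inverse stays below the
    bound [N] because the total weight does. *)
Lemma card_multisets_ge n x r : n <= N -> P x -> r * wt x <= n ->
  #|[set f in multisets n | r <= f x]| = #|multisets (n - r * wt x)|.
Proof.
move=> nN Px rn.
pose upd (g : nat -> nat) f := [ffun y => if y == x then inord (g (f x)) else f y].
have updE (g : nat -> nat) f y : g (f x) <= N ->
    upd g f y = (if y == x then g (f x) else f y) :> nat.
  by move=> gN; rewrite ffunE; case: eqP => //= _; rewrite inordK.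
have sumE (g : nat -> nat) f : g (f x) <= N -> \sum_(y | P y) wt y * upd g f y + wt x * f x
    = \sum_(y | P y) wt y * f y + wt x * g (f x).
  move=> gN; rewrite !(bigD1 x (P := P)) //= updE // eqxx.
  rewrite (eq_bigr (fun y => wt y * f y)); first lia.
  by move=> y /andP[_ /negPf yx]; rewrite updE // yx.
have suppE (g : nat -> nat) f y : (forall z, ~~ P z -> f z = ord0) -> ~~ P y -> upd g f y = ord0.
  by move=> h nPy; rewrite ffunE (h y) //; case: (y =P x) => // yx; rewrite yx Px in nPy.
rewrite -[RHS](card_in_imset (f := upd (addn r))); last first.
  move=> f f' hf hf' e; apply/ffunP => y; apply: val_inj.
  have b (h : {ffun T -> 'I_N.+1}) : h \in multisets (n - r * wt x) -> r + h x <= N.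
    move=> /multisets_le-/(_ x Px) le; apply: leq_trans nN.
    have := wt_gt0 Px; nia.
  have : upd (addn r) f y = upd (addn r) f' y :> nat by rewrite e.
  rewrite !updE ?b //=.
  by case: eqP => // -> /addnI.
apply: eq_card => f; rewrite inE; apply/andP/imsetP => [[fn rf]|[h hn ->]].
  have fN : f x <= N by rewrite -ltnS.
  exists (upd (subn^~ r) f).
    case/multisetsP: (fn) => h0 hs; apply/multisetsP; split => [y|].
      exact: suppE.
    have := sumE (subn^~ r) f (leq_trans (leq_subr _ _) fN).
    rewrite hs mulnBr (mulnC r).
    have := multisets_le fn Px; have : wt x * r <= wt x * f x.
      by rewrite leq_mul2l rf orbT.
    move: (\sum_(_ | _) _) (wt x * f x) (wt x * r) => S u v; lia.
  have sN : f x - r <= N by apply: leq_trans (leq_subr _ _) fN.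
  apply/ffunP => y; apply: val_inj; rewrite /= !updE ?eqxx ?subnKC //.
  by case: (y =P x) => // ->.
have b : r + h x <= N.
  have := multisets_le hn Px; have : r + h x <= (r + h x) * wt x.
    by rewrite leq_pmulr ?wt_gt0.
  rewrite mulnDl (mulnC (h x)); move: (wt x * h x) (r * wt x) rn => u v; lia.
split; last by rewrite updE // eqxx leq_addr.
case/multisetsP: hn => h0 hs; apply/multisetsP; split => [y|].
  exact: suppE.
have := sumE (addn r) h b; rewrite hs; nia.
Qed.

(** The logarithmic derivative of the Euler product, proved by double counting
    without power series: [n] is the sum over [x] of [wt x] times the
    multiplicity of [x], and a multiplicity is the number of [r >= 1] below it,
    so removing [r] copies of [x] leaves total weight [n - r * wt x]. *)
Lemma multisets_recurrence n : n <= N ->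
  n * #|multisets n| =
  \sum_(1 <= j < n.+1) weight_divisor_sum j * #|multisets (n - j)|.
Proof.
move=> nN.
transitivity (\sum_(f in multisets n) \sum_(x | P x) wt x * f x).
  rewrite mulnC -sum_nat_const; apply: eq_bigr => f.
  by move=> /multisetsP[_ ->].
rewrite exchange_big /=.
under [RHS]eq_bigr => j _ do rewrite /weight_divisor_sum big_distrl /=.
rewrite (exchange_big_dep P) /=; last by move=> j x _ /andP[].
apply: eq_bigr => x Px; have w0 := wt_gt0 Px.
rewrite -big_distrr /= -[RHS]big_distrr /=; congr (_ * _).
(* Only the multiples [j = r * wt x] occur on the right. *)
transitivity (\sum_(1 <= r < N.+1 | r * wt x <= n) #|multisets (n - r * wt x)|).
  transitivity (\sum_(f in multisets n) \sum_(1 <= r < N.+1) (r <= f x)).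
    apply: eq_bigr => f _; have := ltn_ord (f x); rewrite ltnS => fN.
    rewrite (@big_cat_nat _ _ _ (f x).+1) //=.
    rewrite [X in _ + X]big_nat [X in _ + X]big1 ?addn0; last first.
      by move=> i /andP[fi _]; rewrite leqNgt fi.
    rewrite big_nat (eq_bigr (fun=> 1)); last first.
      by move=> i /andP[_]; rewrite ltnS => ->.
    by rewrite -big_nat sum_nat_const_nat; lia.
  rewrite exchange_big /= [RHS]big_mkcond /=; apply: eq_bigr => r _.
  case: ifP => rn.
    rewrite -card_multisets_ge // -sum1_card big_mkcond [RHS]big_mkcond /=.
    apply: eq_bigr => f _.
    have -> : (f \in [set f in multisets n | r <= f x])
              = (f \in multisets n) && (r <= f x) by rewrite inE.
    by case: (f \in _) => //=; case: (_ <= _).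
  rewrite big1 // => f fn; have := multisets_le fn Px.
  by case: (leqP r (f x)) => // rf; move: rn; nia.
rewrite -[in RHS]big_filter -[LHS]big_filter.
rewrite -[LHS](big_map (muln^~ (wt x)) predT (fun j => #|multisets (n - j)|)).
apply: perm_big; apply: uniq_perm.
- rewrite map_inj_uniq ?filter_uniq ?iota_uniq // => a b /eqP.
  by rewrite eqn_pmul2r // => /eqP.
- by rewrite filter_uniq ?iota_uniq.
move=> j; rewrite mem_filter mem_index_iota; apply/mapP/andP.
  move=> [r]; rewrite mem_filter mem_index_iota => /andP[h1 h2] ->.
  by split; [rewrite Px dvdn_mull|nia].
move=> [/andP[_ /dvdnP[r ->]] h]; exists r => //.
rewrite mem_filter mem_index_iota; nia.
Qed.

End WeightedMultisets.

Section MultisetCounts.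
Local Open Scope nat_scope.
Variables (T : finType) (N : nat) (P : pred T) (wt : T -> nat).
Hypothesis wt_gt0 : forall x, P x -> 0 < wt x.

Lemma card_multisets0 : #|multisets N P wt 0| = 1.
Proof.
apply/eqP/cards1P; exists [ffun=> ord0].
apply/setP => f; rewrite inE; apply/multisetsP/eqP => [[h0 /eqP hs]|->].
  apply/ffunP => x; rewrite ffunE; case: (boolP (P x)) => Px; last exact: h0.
  move: hs; rewrite sum_nat_eq0 => /forallP/(_ x); rewrite Px /= muln_eq0.
  by rewrite eqn0Ngt wt_gt0 //= => /eqP fx; apply: val_inj.
split=> [x _|]; first by rewrite ffunE.
by rewrite big1 // => x _; rewrite ffunE muln0.
Qed.

(** The recurrence and its solution, in both directions: power sums [k^j] and
    counts [k^n] determine each other. Necklaces supply the former, polynomials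
    the latter. *)
Lemma card_multisets_exp k :
  (forall j, 0 < j <= N -> weight_divisor_sum P wt j = k ^ j) ->
  forall n, n <= N -> #|multisets N P wt n| = k ^ n.
Proof.
move=> wtk; elim/ltn_ind=> -[|n] IH nN; first exact: card_multisets0.
apply/eqP; rewrite -(eqn_pmul2l (ltn0Sn n)) multisets_recurrence //.
rewrite (@eq_big_nat _ _ _ _ _ _ (fun=> k ^ n.+1)) => [|j jn].
  by rewrite sum_nat_const_nat subn1.
rewrite wtk ?IH -?expnD; first by congr (_ ^ _); lia.
all: lia.
Qed.

Lemma weight_divisor_sum_exp k : 0 < k ->
  (forall n, n <= N -> #|multisets N P wt n| = k ^ n) ->
  forall j, 0 < j <= N -> weight_divisor_sum P wt j = k ^ j.
Proof.
move=> k0 msk; elim/ltn_ind=> -[|j] IH // jN.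
have := multisets_recurrence wt_gt0 jN; rewrite big_nat_recr //= subnn.
rewrite card_multisets0 muln1 (@eq_big_nat _ _ _ _ _ _ (fun=> k ^ j.+1)).
  by rewrite sum_nat_const_nat subn1 msk // mulSn; lia.
move=> i ij; rewrite IH ?msk -?expnD; first by congr (_ ^ _); lia.
all: lia.
Qed.

End MultisetCounts.

(** * Multisets with prescribed numbers of objects of each degree *)

Lemma multiplicity_le (n : nat) (c : nat -> nat) :
  (\sum_(1 <= i < n.+1) i * c i)%N = n -> forall i, (0 < i <= n)%N -> (c i <= n)%N.
Proof.
move=> cn i /andP[i0 iN]; rewrite -[leqRHS]cn (big_rem i) ?mem_index_iota ?i0 //=.
by rewrite (leq_trans _ (leq_addr _ _)) // leq_pmull.
Qed.

Section TypedMultisets.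
Local Open Scope nat_scope.
Variables (T : finType) (N : nat).

(** With unit weights all power sums are equal, and the recurrence becomes the
    one satisfied by the binomial coefficients. *)
Lemma card_multisets_unweighted (P : pred T) n : n <= N ->
  #|multisets N P (fun=> 1) n| = 'C(#|P| + n - 1, n).
Proof.
have pE j : weight_divisor_sum P (fun=> 1) j = #|P|.
  rewrite /weight_divisor_sum -sum1_card; apply: eq_bigl => x.
  by rewrite dvd1n andbT.
have rec m : m <= N -> m * #|multisets N P (fun=> 1) m|
    = #|P| * \sum_(i < m) #|multisets N P (fun=> 1) i|.
  move=> mN; rewrite multisets_recurrence // big_add1 big_mkord big_distrr /=.
  rewrite (reindex_inj rev_ord_inj) /=; apply: eq_bigr => i _.
  by rewrite pE subnS subKn //; case: i => /=; lia.
elim: n => [_|n IHn nN].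
  by rewrite bin0 card_multisets0.
have nN' := ltnW nN; apply/eqP; rewrite -(eqn_pmul2l (ltn0Sn n)); apply/eqP.
rewrite rec // big_ord_recr mulnDr -rec //= -mulnDl IHn //.
case: #|P| => [|p].
  by rewrite !add0n; case: (n) => [|n']; rewrite ?mul0n !subn1 /= !bin_small ?muln0.
by rewrite addnS !addSn !subn1 /= !addnS -mul_bin_diag /= addnC.
Qed.

Variables (P : pred T) (deg : T -> nat) (c : nat -> nat).

Definition typed_multisets : {set {ffun T -> 'I_N.+1}} :=
  [set f : {ffun T -> 'I_N.+1} | [forall x, P x || (f x == ord0)]
     && [forall i : 'I_N, \sum_(x | P x && (deg x == i.+1)) f x == c i.+1]].

Lemma typed_multisetsP (f : {ffun T -> 'I_N.+1}) :
  reflect ((forall x, ~~ P x -> f x = ord0) /\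
           (forall i, 0 < i <= N -> \sum_(x | P x && (deg x == i)) f x = c i))
          (f \in typed_multisets).
Proof.
rewrite inE; apply: (iffP andP) => [[/forallP h /forallP h']|[h h']]; split.
- by move=> x nPx; have := h x; rewrite (negPf nPx) => /eqP.
- by move=> [//|i] iN; apply/eqP; exact: (h' (Ordinal iN)).
- by apply/forallP => x; case: (boolP (P x)) => //= /h ->.
- by apply/forallP => i; rewrite h' //=.
Qed.

Lemma sum_by_degree (f : T -> nat) :
  (forall x, P x -> 0 < deg x <= N) ->
  \sum_(x | P x) deg x * f x =
  \sum_(1 <= i < N.+1) i * \sum_(x | P x && (deg x == i)) f x.
Proof.
move=> deg_le; under [RHS]eq_bigr => i _ do rewrite big_distrr /=.
rewrite (exchange_big_dep P) /=; last by move=> i x _ /andP[].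
apply: eq_bigr => x Px; rewrite Px (big_rem (deg x)) ?mem_index_iota ?deg_le //=.
rewrite eqxx big_seq_cond big1 ?addn0 // => i /andP[].
by rewrite mem_rem_uniq ?iota_uniq // inE eq_sym => /andP[/negPf->].
Qed.

Lemma typed_multisets_sub n :
  (forall x, P x -> 0 < deg x <= N) -> \sum_(1 <= i < N.+1) i * c i = n ->
  typed_multisets \subset multisets N P deg n.
Proof.
move=> deg_le cn; apply/subsetP => f /typed_multisetsP[f0 fs].
apply/multisetsP; split=> //; rewrite sum_by_degree // -cn.
by apply: eq_big_nat => i iN; rewrite fs.
Qed.

(** A multiset of a given type is an independent choice, for each degree [i],
    of [c i] objects of degree [i] with repetition. *)
Lemma card_typed_multisets :
  (forall x, P x -> 0 < deg x <= N) -> (forall i, 0 < i <= N -> c i <= N) ->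
  #|typed_multisets| =
  \prod_(1 <= i < N.+1) 'C(#|[pred x | P x & deg x == i]| + c i - 1, c i).
Proof.
move=> deg_le c_le.
pose Q (i : 'I_N) := [pred x | P x & deg x == i.+1].
pose F (i : 'I_N) := multisets N (Q i) (fun=> 1) (c i.+1).
transitivity #|family F|; last first.
  rewrite card_family foldrE big_image big_add1 big_mkord /=.
  by apply: eq_bigr => i _; rewrite card_multisets_unweighted ?c_le /=.
pose split_deg (f : {ffun T -> 'I_N.+1}) : {ffun 'I_N -> {ffun T -> 'I_N.+1}} :=
  [ffun i : 'I_N => [ffun x => if Q i x then f x else ord0]].
have ordP x (Px : P x) : exists i : 'I_N, deg x = i.+1.
  have := deg_le x Px; case: (deg x) => [|d]; first by [].
  by move=> dN; exists (Ordinal dN).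
rewrite -(card_in_imset (f := split_deg)); last first.
  move=> f f' /typed_multisetsP[f0 _] /typed_multisetsP[f0' _] /ffunP e.
  apply/ffunP => x; case: (boolP (P x)) => Px; last by rewrite f0 ?f0'.
  have [i xi] := ordP x Px; have := e i; rewrite !ffunE => /ffunP/(_ x).
  by rewrite !ffunE /= Px xi eqxx.
apply: eq_card => g; apply/imsetP/familyP => [[f /typed_multisetsP[f0 fs] ->] i|gF].
  apply/multisetsP; rewrite ffunE; split=> [x nQ|]; first by rewrite ffunE (negPf nQ).
  rewrite -(fs i.+1) //=; apply: eq_bigr => x Qx.
  by rewrite mul1n ffunE /= Qx.
have gFP i := elimT (multisetsP _ _ _ _) (gF i).
pose f : {ffun T -> 'I_N.+1} := [ffun x => if P x then
  (if insub (deg x).-1 is Some i then g i x else ord0) else ord0].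
have fE (i : 'I_N) x : Q i x -> f x = g i x.
  move=> /andP[/= Px /eqP xi]; rewrite ffunE Px xi /=.
  case: insubP => [j _ /= ji|]; last by rewrite ltn_ord.
  by have -> : j = i by apply: val_inj.
exists f.
  apply/typed_multisetsP; split=> [x nPx|]; first by rewrite ffunE (negPf nPx).
  move=> [//|i] iN; have [_ <-] := gFP (Ordinal iN).
  by apply: eq_bigr => x Qx; rewrite mul1n (fE (Ordinal iN)).
apply/ffunP => i; rewrite ffunE; apply/ffunP => x; rewrite ffunE.
by case: ifP => [/fE->//|nQ]; have [-> //] := gFP i; rewrite nQ.
Qed.

End TypedMultisets.

(** * The Moebius function *)

Section MoebiusInversion.

Lemma big_divisors (R : nmodType) (n N : nat) (F : nat -> R) : (0 < n <= N)%N ->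
  \sum_(d <- divisors n) F d = \sum_(1 <= d < N.+1 | (d %| n)%N) F d.
Proof.
move=> /andP[n0 nN]; rewrite -[RHS]big_filter; apply/perm_big/uniq_perm.
- exact: divisors_uniq.
- by rewrite filter_uniq ?iota_uniq.
move=> d; rewrite -dvdn_divisors // mem_filter mem_index_iota.
case: (boolP (d %| n)%N) => //= dn.
by rewrite (dvdn_gt0 n0 dn) ltnS (leq_trans (dvdn_leq n0 dn) nN).
Qed.

(** Only squarefree numbers matter to the Moebius function, so multiplying by a
    new prime flips the sign and multiplying by an old one gives zero. *)
Lemma moebius_mul_prime p e : prime p -> (0 < e)%N -> ~~ (p %| e)%N ->
  moebius (p * e) = - moebius e.
Proof.
move=> pp e0 pe; have p0 := prime_gt0 pp.
have pr : perm_eq (primes (p * e)) (p :: primes e).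
  apply: uniq_perm; rewrite ?primes_uniq //= ?mem_primes ?pp ?e0 ?(negPf pe) //.
    by rewrite primes_uniq.
  by move=> q; rewrite primesM // inE primes_prime // mem_seq1.
have pp' : p \notin primes e by rewrite mem_primes pp e0 (negPf pe).
rewrite /moebius (perm_all _ pr) (perm_size pr) /= lognM // (logn_prime p pp) eqxx.
have -> : logn p e = 0%N by rewrite lognE pp e0 (negPf pe).
have -> : all (fun q => logn q (p * e) == 1%N) (primes e)
          = all (fun q => logn q e == 1%N) (primes e).
  apply: eq_in_all => q qe; rewrite lognM // (logn_prime q pp).
  by case: (q =P p) => // qp; rewrite -qp qe in pp'.
by rewrite addn0 /=; case: ifP; rewrite ?oppr0 // exprS mulN1r.
Qed.

Lemma moebius_mul_prime_dvd p e : prime p -> (0 < e)%N -> (p %| e)%N ->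
  moebius (p * e) = 0.
Proof.
move=> pp e0 pe; have p0 := prime_gt0 pp; rewrite /moebius ifF //.
apply/negbTE/allPn; exists p; first by rewrite mem_primes pp muln_gt0 p0 e0 dvdn_mulr.
by rewrite lognM // (logn_prime p pp) eqxx add1n eqSS -lt0n logn_gt0 mem_primes pp e0.
Qed.

(** Pick a prime [p] dividing [n]: the divisors prime to [p] cancel against
    their multiples by [p], and the other divisors contribute zero. *)
Lemma sum_moebius n : (0 < n)%N ->
  \sum_(d <- divisors n) moebius d = (n == 1%N)%:R.
Proof.
move=> n0; case: (eqVneq n 1%N) => [->|n1].
  by rewrite (_ : divisors 1 = [:: 1%N]) // big_seq1.
pose p := pdiv n; have pp : prime p by rewrite pdiv_prime //; lia.
have p0 := prime_gt0 pp; have pn : (p %| n)%N by exact: pdiv_dvd.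
rewrite (@big_divisors _ n n) ?n0 ?leqnn // (bigID (dvdn p)) /=.
have -> : \sum_(1 <= d < n.+1 | (d %| n)%N && (p %| d)%N) moebius d
    = \sum_(1 <= e < n.+1 | (p * e %| n)%N) moebius (p * e).
  rewrite -[in LHS]big_filter -[RHS]big_filter -[RHS](big_map (muln p) predT).
  apply/perm_big/uniq_perm.
  - by rewrite filter_uniq ?iota_uniq.
  - rewrite map_inj_uniq ?filter_uniq ?iota_uniq // => a b /eqP.
    by rewrite eqn_pmul2l // => /eqP.
  move=> d; rewrite mem_filter mem_index_iota; apply/idP/mapP.
    move=> /andP[/andP[dn /dvdnP[e de]] dN]; exists e; last by rewrite mulnC.
    rewrite mem_filter mem_index_iota mulnC -de dn /=.
    have := dvdn_leq n0 dn; nia.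
  move=> [e]; rewrite mem_filter mem_index_iota => /andP[en eN] ->.
  rewrite en dvdn_mulr //= ltnS (dvdn_leq n0 en) andbT muln_gt0 p0.
  by case/andP: eN.
rewrite (bigID (dvdn p)) /= big_nat_cond big1 ?add0r; last first.
  by move=> e /andP[/andP[e0 _] /andP[_ pe]]; exact: moebius_mul_prime_dvd.
rewrite (eq_bigl (fun e => (e %| n)%N && ~~ (p %| e)%N)); last first.
  move=> e; case: (boolP (p %| e)%N); rewrite ?andbF ?andbT // => pe.
  by rewrite Gauss_dvd ?pn // prime_coprime.
rewrite big_nat_cond [X in _ + X]big_nat_cond -big_split big1 // => e.
by move=> /andP[/andP[e0 _] /andP[_ pe]]; rewrite /= moebius_mul_prime ?addNr.
Qed.

Lemma moebius_inversion (g p : nat -> rat) n : (0 < n)%N ->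
  (forall j, (0 < j <= n)%N -> \sum_(d <- divisors j) g d = p j) ->
  g n = \sum_(d <- divisors n) (moebius d)%:~R * p (n %/ d)%N.
Proof.
move=> n0 gp; rewrite (@big_divisors _ n n) ?n0 ?leqnn //.
transitivity (\sum_(1 <= d < n.+1 | (d %| n)%N)
   \sum_(1 <= e < n.+1 | (e %| n %/ d)%N) (moebius d)%:~R * g e); last first.
  rewrite [LHS]big_nat_cond [RHS]big_nat_cond; apply: eq_bigr => d.
  move=> /andP[/andP[d0 _] dn]; rewrite -mulr_sumr; congr (_ * _).
  have nd : (0 < n %/ d <= n)%N by rewrite divn_gt0 // (dvdn_leq n0 dn) leq_div.
  by rewrite -(gp _ nd) -big_divisors.
rewrite (exchange_big_dep_nat (fun e => e %| n)%N) /=; last first.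
  by move=> d e _ _ dn edn; apply: (dvdn_trans edn); exact: dvdn_div.
transitivity (\sum_(1 <= e < n.+1 | (e %| n)%N) (e == n)%:R * g e).
  rewrite big_mkcond (bigD1_seq n) ?iota_uniq ?mem_index_iota ?n0 ?ltnS //=.
  rewrite dvdnn eqxx mul1r big1 ?addr0 // => e /negPf->.
  by rewrite mul0r if_same.
rewrite [LHS]big_nat_cond [RHS]big_nat_cond; apply: eq_bigr => e.
move=> /andP[/andP[e0 _] en]; rewrite -mulr_suml; congr (_ * _).
have ne0 : (0 < n %/ e <= n)%N by rewrite divn_gt0 // (dvdn_leq n0 en) leq_div.
rewrite (eq_bigl (fun d => d %| n %/ e)%N) => [|d].
  rewrite -big_divisors // -rmorph_sum /= sum_moebius; last by case/andP: ne0.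
  suff -> : (n %/ e == 1)%N = (e == n) by case: eqP.
  by rewrite -(eqn_pmul2r e0) mul1n divnK // eq_sym.
apply/andP/idP => [[dn]|dne].
  by rewrite !dvdn_divRL // mulnC.
have dn : (d %| n)%N by apply: (dvdn_trans dne); exact: dvdn_div.
by split=> //; move: dne; rewrite !dvdn_divRL // mulnC.
Qed.

End MoebiusInversion.

(** Grouping the objects by weight shows that [d] times the number of objects
    of weight [d] sums to [k^j] over the divisors [d] of [j]; Moebius inversion
    isolates each weight. *)
Lemma weight_count_moebius (T : finType) (N k : nat) (P : pred T) (wt : T -> nat) :
  (forall x, P x -> 0 < wt x)%N ->
  (forall j, 0 < j <= N -> weight_divisor_sum P wt j = k ^ j)%N ->
  forall i, (0 < i <= N)%N ->
  #|[pred x | P x & wt x == i]|%:R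
    = i%:R^-1 * \sum_(d <- divisors i) (moebius d)%:~R * k%:R ^+ (i %/ d) :> rat.
Proof.
move=> wt_gt0 wtk i /andP[i0 iN]; set Q := fun j => [pred x | P x & wt x == j].
rewrite -(@moebius_inversion (fun d => d%:R * #|Q d|%:R)) //.
  by rewrite mulKf // pnatr_eq0 -lt0n.
move=> j /andP[j0 ji]; rewrite -natrX -wtk ?j0 ?(leq_trans ji) //.
rewrite (@big_divisors _ j j) ?j0 ?leqnn // natr_sum.
rewrite (partition_big (fun x => inord (wt x) : 'I_j.+1) (fun d => val d %| j)%N) /=.
  rewrite big_add1 /= big_mkord big_mkcond [RHS]big_mkcond big_ord_recl /=.
  rewrite dvd0n eqn0Ngt j0 add0r; apply: eq_bigr => d _.
  rewrite /bump /= add1n; case: ifP => // dj.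
  rewrite -natrM mulnC -sum_nat_const natr_sum; apply: eq_big => [x|x].
    rewrite inE; case: (boolP (P x)) => //= _.
    apply/eqP/andP => [wx|[wj /eqP/(congr1 val)]].
      by split; [rewrite wx|apply/eqP/val_inj; rewrite /= inordK wx // ltnS dvdn_leq].
    by rewrite /= inordK // ltnS dvdn_leq.
  by rewrite inE => /andP[_ /eqP->].
by move=> x /andP[Px wj]; rewrite inordK // ltnS dvdn_leq.
Qed.

(** * Orbits of a permutation and cycle types *)

Section Orbits.
Local Open Scope nat_scope.
Variables (T : finType) (s : {perm T}).

(** The trajectory of [x] has no repetition before its first return. *)
Lemma porbit_size_dvd x j : (#|porbit s x| %| j) = ((s ^+ j)%g x == x).
Proof.
set d := #|porbit s x|; have d0 : 0 < d by rewrite lt0n card_porbit_neq0.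
have sd i : (s ^+ (i * d))%g x = x.
  elim: i => [|i IH]; first by rewrite mul0n expg0 perm1.
  by rewrite mulSn expgD permM [(s ^+ d)%g x]permX iter_porbit IH.
rewrite {2}(divn_eq j d) expgD permM sd /dvdn.
have := uniq_traject_porbit s x; rewrite -/d => /nth_uniq-/(_ x (j %% d) 0).
rewrite size_traject ltn_pmod // d0 => /(_ isT isT).
by rewrite !nth_traject ?ltn_pmod //= -permX eq_sym => ->; rewrite eq_sym.
Qed.

Lemma sum_porbits (A : pred {set T}) (F : T -> nat) :
  \sum_(C in porbits s | A C) \sum_(x in C) F x
  = \sum_(x | A (porbit s x)) F x.
Proof.
rewrite [RHS](partition_big (porbit s) [pred C in porbits s | A C]) /=.
  apply: eq_bigr => _ /andP[/imsetP[y _ ->] Ay]; apply: eq_bigl => x.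
  by rewrite -eq_porbit_mem; case: eqP => [->|]; rewrite ?Ay ?andbF.
by move=> x ->; rewrite imset_f.
Qed.

Lemma card_porbits_size i :
  #|[set C in porbits s | #|C| == i]| * i = #|[set x | #|porbit s x| == i]|.
Proof.
rewrite -sum_nat_const -[RHS]sum1_card.
transitivity (\sum_(C in porbits s | #|C| == i) \sum_(x in C) 1).
  by apply: eq_big => [C|C]; rewrite inE // => /andP[_ /eqP<-]; rewrite sum1_card.
by rewrite (sum_porbits (fun C => #|C| == i)); apply: eq_bigl => x; rewrite inE.
Qed.

(** Used twice: for conjugation, and for the map sending a position to the word
    read from it. *)
Lemma card_porbit_equivariant (T' : finType) (t : {perm T'}) (h : T -> T') x :
  (forall y, h (s y) = t (h y)) -> {in porbit s x &, injective h} ->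
  #|porbit t (h x)| = #|porbit s x|.
Proof.
move=> hst hinj; rewrite -(card_in_imset hinj); apply: eq_card => y.
have hX i z : h ((s ^+ i)%g z) = (t ^+ i)%g (h z).
  by rewrite !permX; elim: i => //= i <-; rewrite hst.
apply/porbitP/imsetP => [[i ->]|[z /porbitP[i ->] ->]]; last by exists i.
by exists ((s ^+ i)%g x); rewrite ?mem_porbit.
Qed.

End Orbits.

Section CycleType.
Local Open Scope nat_scope.
Variable n : nat.
Implicit Types w : 'S_n.

Definition has_cycle_type (c : nat -> nat) w : bool :=
  [forall i : 'I_n, ncycles i.+1 w == c i.+1].

Lemma has_cycle_typeP c w :
  reflect (forall i, 0 < i <= n -> ncycles i w = c i) (has_cycle_type c w).
Proof.
apply: (iffP forallP) => [h [//|i] iN|h i]; last by rewrite h /=.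
by apply/eqP; exact: (h (Ordinal iN)).
Qed.

Lemma ncycles_gt i w : n < i -> ncycles i w = 0.
Proof.
move=> ni; apply/eqP; rewrite cards_eq0; apply/eqP/setP => C; rewrite !inE.
apply/andP => -[_ /eqP Ci]; have := max_card (mem C).
by rewrite Ci card_ord leqNgt ni.
Qed.

Lemma ncycles_mul i w : ncycles i w * i = #|[set x | #|porbit w x| == i]|.
Proof. exact: card_porbits_size. Qed.

Lemma ncyclesV i w : ncycles i (w^-1)%g = ncycles i w.
Proof. by rewrite /ncycles porbitsV. Qed.

Lemma ncyclesJ i w (r : 'S_n) : 0 < i -> ncycles i (w ^ r)%g = ncycles i w.
Proof.
move=> i0; apply/eqP; rewrite -(eqn_pmul2r i0) !ncycles_mul; apply/eqP.
rewrite -[RHS](card_imset _ (@perm_inj _ r)); apply: eq_card => x.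
have e y : #|porbit (w ^ r)%g (r y)| = #|porbit w y|.
  apply: card_porbit_equivariant => [z|]; last by move=> ? ? _ _; exact: perm_inj.
  by rewrite permJ.
rewrite inE; apply/idP/imsetP => [h|[y + ->]]; last by rewrite inE e.
by exists ((r^-1)%g x); rewrite ?inE -?e permKV.
Qed.

Lemma sum_ncycles w : \sum_(1 <= i < n.+1) i * ncycles i w = n.
Proof.
rewrite big_add1 big_mkord /=.
transitivity (\sum_(i < n) \sum_(x | #|porbit w x| == i.+1) 1).
  apply: eq_bigr => i _; rewrite mulnC ncycles_mul -sum1_card.
  by apply: eq_bigl => x; rewrite inE.
have pn (x : 'I_n) : #|porbit w x|.-1 < n.
  by have := max_card (mem (porbit w x)); rewrite card_ord; case: #|_| (card_porbit_neq0 w x).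
rewrite -[RHS]card_ord -[RHS]sum1_card [RHS](partition_big (fun x => Ordinal (pn x)) xpredT) //=.
apply: eq_bigr => i _.
apply: eq_bigl => x; rewrite -val_eqE /=.
by case: #|porbit w x| (card_porbit_neq0 w x) => // d _; rewrite eqSS.
Qed.

End CycleType.

(** * Words up to rotation, and words sorted by permutations *)

Section Shift.
Local Open Scope nat_scope.
Variables (L k : nat).
Implicit Type x : {ffun 'I_L -> 'I_k}.

Definition shift_word x : {ffun 'I_L -> 'I_k} := [ffun t => x (ordS t)].

Lemma shift_word_inj : injective shift_word.
Proof.
move=> x y /ffunP e; apply/ffunP => t; have := e (ord_pred t).
by rewrite !ffunE ord_predK.
Qed.

(** Infinite words whose period divides [L] are functions on ['I_L]. The orbits
    of the shift are then the primitive necklaces whose length divides [L], the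
    length being the size of the orbit. *)
Definition shift : {perm {ffun 'I_L -> 'I_k}} := perm shift_word_inj.

Lemma shiftE x t : shift x t = x (ordS t).
Proof. by rewrite permE ffunE. Qed.

Lemma shiftXE j x t : (shift ^+ j)%g x t = x (iter j (@ordS L) t).
Proof.
by elim: j t => [|j IH] t; rewrite ?expg0 ?perm1 // expgSr permM shiftE IH -iterSr.
Qed.

Lemma val_iter_ordS j (t : 'I_L) : iter j (@ordS L) t = (t + j) %% L :> nat.
Proof.
elim: j => [|j IH] /=; first by rewrite addn0 modn_small.
by rewrite IH -addn1 modnDml addn1 addnS.
Qed.

(** A word with period [j] is given by its first [j] letters. *)
Lemma card_shift_fixed j : 0 < j -> 0 < L -> j %| L ->
  #|[set x | (shift ^+ j)%g x == x]| = k ^ j.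
Proof.
move=> j0 L0 jL; have jleL := dvdn_leq L0 jL.
pose rep (y : {ffun 'I_j -> 'I_k}) : {ffun 'I_L -> 'I_k} :=
  [ffun t : 'I_L => y (Ordinal (ltn_pmod t j0))].
transitivity #|rep @: [set: {ffun 'I_j -> 'I_k}]|; last first.
  rewrite card_imset ?cardsT ?card_ffun ?card_ord // => y y' /ffunP e.
  apply/ffunP => t; have := e (widen_ord jleL t); rewrite !ffunE.
  suff -> : Ordinal (ltn_pmod (widen_ord jleL t) j0) = t by [].
  by apply: val_inj; rewrite /= modn_small.
apply: eq_card => x; rewrite inE; apply/eqP/imsetP => [fx|[y _ ->]]; last first.
  apply/ffunP => t; rewrite shiftXE !ffunE; congr (y _); apply: val_inj => /=.
  by rewrite val_iter_ordS modn_dvdm // modnDr.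
exists [ffun t => x (widen_ord jleL t)]; first by rewrite inE.
apply/ffunP => t; rewrite !ffunE.
have per i : (shift ^+ (i * j))%g x = x.
  elim: i => [|i IH]; first by rewrite mul0n expg0 perm1.
  by rewrite mulSn expgD permM fx IH.
set u := widen_ord _ _.
have tu : iter (t %/ j * j) (@ordS L) u = t.
  by apply: val_inj; rewrite /= val_iter_ordS /= addnC -divn_eq modn_small.
by rewrite -{1}tu -shiftXE per.
Qed.

End Shift.

Section Standardization.
Local Open Scope nat_scope.
Variables n k : nat.
Implicit Types (w : 'S_n) (s v : {ffun 'I_n -> 'I_k}).

(** Equivalently (see [compatible_adjP]), [s] increases weakly, and strictly at
    each descent of [w]. *)
Definition compatible w s : bool :=
  [forall i : 'I_n, forall j : 'I_n,
     (i < j) ==> ((s i < s j) || ((s i == s j) && (w i < w j)))].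

Lemma compatibleP w s :
  reflect (forall i j : 'I_n, i < j -> s i < s j \/ s i = s j /\ w i < w j)
          (compatible w s).
Proof.
apply: (iffP forallP) => [h i j ij|h i].
  by have /forallP/(_ j) := h i; rewrite ij => /orP[|/andP[/eqP]]; [left|right].
apply/forallP => j; apply/implyP => ij; apply/orP.
by case: (h i j ij) => [|[-> wij]]; [left|right; rewrite eqxx].
Qed.

Lemma compatible_stable w s (i j : 'I_n) : compatible w s -> s i = s j -> i < j -> w i < w j.
Proof.
by move=> /compatibleP h sij /h[|[]//]; rewrite sij ltnn.
Qed.

Lemma compatible_monotone w s (i j : 'I_n) : compatible w s -> i <= j -> s i <= s j.
Proof.
move=> /compatibleP h; rewrite leq_eqVlt => /orP[/eqP/val_inj->//|].
by move=> /h[/ltnW//|[-> _]].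
Qed.

(** The stable sort of a word: positions are ordered by letter first, then by
    index. *)
Lemma exists_compatible v : exists w, compatible w [ffun i => v (w i)].
Proof.
pose r (i j : 'I_n) := (v i < v j) || ((v i == v j) && (i <= j)).
have r_total : total r.
  by move=> i j; rewrite /r -!val_eqE /=; lia.
have r_trans : transitive r.
  by move=> j i l; rewrite /r -!val_eqE /=; lia.
pose l := sort r (enum 'I_n).
have lsz : size l = n by rewrite size_sort size_enum_ord.
have luniq : uniq l by rewrite sort_uniq enum_uniq.
have linj : injective (fun i : 'I_n => tnth (Tuple (introT eqP lsz)) i).
  by move=> i j /eqP; rewrite !(tnth_nth i) /= nth_uniq ?lsz // => /eqP/val_inj.
exists (perm linj); apply/compatibleP => i j ij; rewrite !ffunE !permE.
have := sorted_ltn_nth r_trans i (sort_sorted r_total (enum 'I_n)).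
have lt_l (h : 'I_n) : h < size l by rewrite lsz.
move=> /(_ i j (lt_l i) (lt_l j) ij); rewrite -/l.
rewrite !(tnth_nth i) /= /r => /orP[|/andP[/eqP e le]]; [by left|right; split=> //].
rewrite ltn_neqAle le andbT; apply/eqP => /val_inj/eqP.
by rewrite nth_uniq ?lsz // => /eqP e'; rewrite e' ltnn in ij.
Qed.

Definition compatible_pairs : {set 'S_n * {ffun 'I_n -> 'I_k}} :=
  [set p | compatible p.1 p.2].

(** A word is recovered from its sorted form and the sorting permutation. *)
Lemma card_compatible_pairs_ge : k ^ n <= #|compatible_pairs|.
Proof.
have st v : {w | compatible w [ffun i => v (w i)]}.
  exact: (sigW (exists_compatible v)).
pose f v := (sval (st v), [ffun i => v (sval (st v) i)]).
rewrite -[X in X ^ _]card_ord -[X in _ ^ X]card_ord -card_ffun -cardsT.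
rewrite -(card_imset _ (f := f)).
  by apply/subset_leq_card/subsetP => _ /imsetP[v _ ->]; rewrite inE; exact: (svalP (st v)).
move=> v v' []; move: (sval _) (sval _) => w w' <- /ffunP e.
by apply/ffunP => i; have := e ((w'^-1)%g i); rewrite !ffunE permKV.
Qed.

End Standardization.

(** * Reading a word along the cycles of a permutation *)

Section Itineraries.
Local Open Scope nat_scope.
Variables n k : nat.
Local Notation L := n`!.
Local Notation word := {ffun 'I_L -> 'I_k}.
Local Notation shift := (shift L k).
Implicit Types (w : 'S_n) (s : {ffun 'I_n -> 'I_k}).

(** The word read by following the cycle of [w] through [j]. The length [n!] is
    a multiple of the order of [w], so nothing is lost by reading cyclically. *)
Definition itinerary w s (j : 'I_n) : word := [ffun t : 'I_L => s ((w ^+ t)%g j)].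

Lemma perm_expg_fact w : (w ^+ L = 1)%g.
Proof.
have /dvdnP[q] : #[w]%g %| L.
  by rewrite -(card_Sn n) -cardsT orderE cardSg ?subsetT.
by rewrite mulnC => ->; rewrite expgM expg_order expg1n.
Qed.

Lemma itinerary_perm w s j : itinerary w s (w j) = shift (itinerary w s j).
Proof.
apply/ffunP => t; rewrite shiftE !ffunE /= expg_mod ?perm_expg_fact //.
by rewrite expgS permM.
Qed.

Lemma itinerary_permX r w s j :
  itinerary w s ((w ^+ r)%g j) = (shift ^+ r)%g (itinerary w s j).
Proof.
elim: r => [|r IH]; first by rewrite !expg0 !perm1.
by rewrite !expgSr !permM itinerary_perm IH.
Qed.

Lemma itinerary0 w s j (t0 : 'I_L) : t0 = 0 :> nat -> itinerary w s j t0 = s j.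
Proof. by move=> t00; rewrite ffunE t00 expg0 perm1. Qed.

(** An increasing self-map of a finite chain moves nothing: the last element
    moved upwards, or the first one moved downwards, would be followed, or
    preceded, by another. *)
Lemma increasing_fix (g : 'I_n -> 'I_n) (S : pred 'I_n) :
  (forall i, S i -> S (g i)) ->
  (forall i j, S i -> S j -> i < j -> g i < g j) ->
  forall i, S i -> g i = i.
Proof.
move=> gS gmono i Si; apply: val_inj; apply/eqP; rewrite eqn_leq.
apply/andP; split; rewrite leqNgt; apply/negP => lt.
- have Pi : S i && (i < g i) by rewrite Si.
  case: (@arg_maxnP _ i (fun j : 'I_n => S j && (j < g j)) (@nat_of_ord n) Pi).
  move=> j /andP[Sj jg] /(_ (g j)); rewrite gS // gmono ?gS // => /(_ isT) le.
  by have : g j <= j by []; rewrite leqNgt jg.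
- have Pi : S i && (g i < i) by rewrite Si.
  case: (@arg_minnP _ i (fun j : 'I_n => S j && (g j < j)) (@nat_of_ord n) Pi).
  move=> j /andP[Sj jg] /(_ (g j)); rewrite gS // gmono ?gS // => /(_ isT) le.
  by have : j <= g j by []; rewrite leqNgt jg.
Qed.

Lemma fact_ord0 : exists t0 : 'I_L, t0 = 0 :> nat.
Proof. by exists (Ordinal (fact_gt0 n)). Qed.

Lemma itinerary_fiber_letter w s i j : itinerary w s i = itinerary w s j -> s i = s j.
Proof.
have [t0 h] := fact_ord0 => /ffunP/(_ t0).
by rewrite !itinerary0.
Qed.

Lemma itinerary_fiber_mono r w s (i j : 'I_n) : compatible w s ->
  itinerary w s i = itinerary w s j -> i < j -> (w ^+ r)%g i < (w ^+ r)%g j.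
Proof.
move=> cws eij ij; elim: r => [|r IH]; first by rewrite expg0 !perm1.
rewrite !expgSr !permM; apply: (compatible_stable cws) => //.
by apply: (@itinerary_fiber_letter w); rewrite !itinerary_permX eij.
Qed.

(** The words read along a cycle are primitive. If two positions of a cycle
    read the same word, then the power of [w] taking one to the other preserves
    the set of positions reading that word and increases on it, so it fixes
    them. *)
Lemma itinerary_inj_orbit w s j : compatible w s ->
  {in porbit w j &, injective (itinerary w s)}.
Proof.
move=> cws y z yj zj eyz.
have /porbitP[r zr] : z \in porbit w y.
  by move: yj zj; rewrite -!eq_porbit_mem => /eqP-> /eqP->.
rewrite zr; apply/esym.
apply: (increasing_fix (S := fun i => itinerary w s i == itinerary w s y)) => //.
  by move=> i /eqP e; rewrite itinerary_permX e -itinerary_permX -zr eyz.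
move=> i i' /eqP e /eqP e'.
exact: (itinerary_fiber_mono r cws (etrans e (esym e'))).
Qed.

Definition trace w s l (j : 'I_n) : seq nat :=
  mkseq (fun t => val (s ((w ^+ t)%g j))) l.

Lemma traceS w s l j : trace w s l.+1 j = val (s j) :: trace w s l (w j).
Proof.
rewrite /trace /mkseq /= expg0 perm1 -add1n iotaDl -map_comp; congr (_ :: _).
by apply: eq_map => t /=; rewrite expgS permM.
Qed.

(** Positions are sorted by the words read from them, in lexicographic order:
    equal first letters pass the comparison on to the images under [w], which
    stay in the same order. *)
Lemma trace_mono w s l (i j : 'I_n) : compatible w s -> i <= j ->
  (trace w s l i <= trace w s l j :> seqlexi nat)%O.
Proof.
move=> cws; elim: l i j => [//|l IH] i j ij.
rewrite !traceS lexi_cons leEnat (compatible_monotone cws ij) /=.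
apply/implyP => ji; move: ij; rewrite leq_eqVlt => /orP[/eqP/val_inj->//|ij].
apply: IH; apply/ltnW/(compatible_stable cws) => //; apply: val_inj; apply/eqP.
by rewrite eqn_leq ji (compatible_monotone cws (ltnW ij)).
Qed.

Definition letters (x : word) : seq nat := [seq val (x t) | t <- enum 'I_L].

Lemma letters_inj : injective letters.
Proof.
move=> x y /eq_in_map e; apply/ffunP => t; apply: val_inj.
by apply: e; rewrite mem_enum.
Qed.

Lemma letters_itinerary w s j : letters (itinerary w s j) = trace w s L j.
Proof.
rewrite /trace /mkseq -val_enum_ord -map_comp; apply: eq_map => t /=.
by rewrite ffunE.
Qed.

Definition visits w s (x : word) := #|[set j | itinerary w s j == x]|.

(** Both families of words are sorted, so they agree as soon as they agree up to
    order. *)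
Lemma itinerary_determined w s w' s' : compatible w s -> compatible w' s' ->
  visits w s =1 visits w' s' -> itinerary w s =1 itinerary w' s'.
Proof.
move=> cws cws' ev.
have sorted_tr u v : compatible u v ->
    sorted (fun a b : seqlexi nat => a <= b)%O [seq trace u v L j | j <- enum 'I_n].
  move=> cuv; apply: (homo_sorted (e := fun i j : 'I_n => i <= j)) => [i j|].
    exact: trace_mono.
  by have := iota_sorted 0 n; rewrite -val_enum_ord sorted_map.
have perm_tr : perm_eq [seq trace w s L j | j <- enum 'I_n]
                       [seq trace w' s' L j | j <- enum 'I_n].
  have trE u v : [seq trace u v L j | j <- enum 'I_n]
      = map letters (map (itinerary u v) (enum 'I_n)).
    by rewrite -map_comp; apply: eq_map => j /=; rewrite letters_itinerary.
  rewrite !trE; apply: perm_map; apply/allP => x _ /=.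
  have countE u v : count_mem x [seq itinerary u v j | j <- enum 'I_n] = visits u v x.
    rewrite count_map -size_filter /visits cardE [in RHS]/enum_mem.
    by rewrite enumT; congr (size _); apply: eq_filter => j; rewrite /= in_set.
  by rewrite !countE ev.
have := le_sorted_eq (sorted_tr _ _ cws) (sorted_tr _ _ cws') perm_tr.
move=> /eq_in_map e j; apply: letters_inj; rewrite !letters_itinerary.
by apply: e; rewrite mem_enum.
Qed.

(** The letters of [s] are the first letters of the itineraries. As for the
    permutations, [w * w'^-1] preserves each set of positions with a common
    itinerary and increases on it, so it is the identity. *)
Lemma compatible_determined w s w' s' : compatible w s -> compatible w' s' ->
  visits w s =1 visits w' s' -> w = w' /\ s = s'.
Proof.
move=> cws cws' ev; have ei := itinerary_determined cws cws' ev.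
have es : s = s'.
  have [t0 h] := fact_ord0; apply/ffunP => j.
  by rewrite -(itinerary0 w s j h) -(itinerary0 w' s' j h) ei.
split=> //; apply/permP => j; apply: (@perm_inj _ w'^-1%g); rewrite permK.
rewrite -permM; pose g := (w * w'^-1)%g.
have fib i : itinerary w s (g i) = itinerary w s i.
  apply: (@perm_inj _ shift); rewrite ei -itinerary_perm permM permKV.
  by rewrite -ei itinerary_perm.
apply: (increasing_fix (S := fun i => itinerary w s i == itinerary w s j)) => //.
  by move=> i /eqP e; rewrite -/g fib e.
move=> i i' /eqP e /eqP e' ii'; rewrite -/g ltnNge; apply/negP => le.
have lt_w : w i < w i'.
  by apply: (compatible_stable cws) => //; apply: (@itinerary_fiber_letter w); rewrite e e'.
have gK a : w' (g a) = w a by rewrite permM permKV.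
move: le; rewrite leq_eqVlt => /orP[/eqP/val_inj/perm_inj ee|lt].
  by rewrite ee ltnn in ii'.
have := compatible_stable cws' _ lt; rewrite !gK ltnNge (ltnW lt_w) => h; apply/notF/h.
by rewrite -es; apply: (@itinerary_fiber_letter w); rewrite !fib e e'.
Qed.

End Itineraries.

(** * Cycle types and multisets of primitive necklaces *)

Section NecklaceProfiles.
Local Open Scope nat_scope.
Variables n k : nat.
Local Notation L := n`!.
Local Notation word := {ffun 'I_L -> 'I_k}.
Local Notation shift := (shift L k).
Implicit Types (w : 'S_n) (s : {ffun 'I_n -> 'I_k}) (x : word) (C : {set word}).

(** Cycles of a permutation of [n] points only produce necklaces of length at
    most [n]. *)
Definition necklace C : bool := (C \in porbits shift) && (#|C| <= n).

(** The multiplicity of a necklace is the number of cycles reading it. The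
    number of positions reading [x] is constant when [x] runs over a necklace,
    so the maximum is just a choice-free way to name the common value. *)
Definition profile w s : {ffun {set word} -> 'I_n.+1} :=
  [ffun C => if necklace C then inord (\max_(x in C) visits w s x) else ord0].

Lemma necklace_gt0 C : necklace C -> 0 < #|C|.
Proof.
by move=> /andP[/imsetP[x _ ->] _]; rewrite lt0n card_porbit_neq0.
Qed.

Lemma visits_le w s x : visits w s x <= n.
Proof. by have := max_card (mem [set j | itinerary w s j == x]); rewrite card_ord. Qed.

Lemma visits_shift w s x : visits w s (shift x) = visits w s x.
Proof.
rewrite /visits -[RHS](card_imset _ (@perm_inj _ w)); apply: eq_card => j.
rewrite inE; apply/eqP/imsetP => [e|[i + ->]]; last first.
  by rewrite inE itinerary_perm => /eqP->.
exists ((w^-1)%g j); rewrite ?permKV // inE.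
by apply/eqP/(@perm_inj _ shift); rewrite -itinerary_perm permKV.
Qed.

Lemma visits_orbit w s x y : x \in porbit shift y -> visits w s x = visits w s y.
Proof.
move=> /porbitP[i ->]; elim: i => [|i IH]; first by rewrite expg0 perm1.
by rewrite expgSr permM visits_shift.
Qed.

Lemma profileE w s C x : necklace C -> x \in C -> profile w s C = visits w s x :> nat.
Proof.
move=> nC xC; rewrite ffunE nC; case/andP: (nC) => /imsetP[y _ eC] _.
have -> : \max_(z in C) visits w s z = visits w s x.
  apply/eqP; rewrite eqn_leq (leq_bigmax_cond _ xC) andbT; apply/bigmax_leqP => z zC.
  rewrite eC in xC zC; rewrite leq_eqVlt; apply/orP; left; apply/eqP.
  by rewrite (visits_orbit _ _ zC) (visits_orbit _ _ xC).
by rewrite inordK // ltnS visits_le.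
Qed.

Lemma card_porbit_itinerary w s j : compatible w s ->
  #|porbit shift (itinerary w s j)| = #|porbit w j|.
Proof.
move=> cws; apply: card_porbit_equivariant; last exact: itinerary_inj_orbit.
by move=> i; rewrite itinerary_perm.
Qed.

Lemma visits_long w s x : compatible w s -> n < #|porbit shift x| -> visits w s x = 0.
Proof.
move=> cws nx; apply/eqP; rewrite cards_eq0; apply/eqP/setP => j; rewrite !inE.
apply/eqP => jx; move: nx; rewrite -jx card_porbit_itinerary //.
by have := max_card (mem (porbit w j)); rewrite card_ord ltnNge => ->.
Qed.

(** Each position reads exactly one word, and the cycle through it has the
    length of the necklace of that word; [A] selects lengths. *)
Lemma sum_profile (A : pred nat) w s : compatible w s ->
  \sum_(C | necklace C && A #|C|) #|C| * profile w s C
  = #|[set j | A #|porbit w j|]|.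
Proof.
move=> cws.
transitivity (\sum_(C in porbits shift | (#|C| <= n) && A #|C|) \sum_(x in C) visits w s x).
  apply: eq_big => [C|C /andP[nC _]]; first by rewrite andbA.
  by rewrite -sum_nat_const; apply: eq_bigr => x xC; rewrite -(profileE w s nC xC).
rewrite (sum_porbits _ (fun C => (#|C| <= n) && A #|C|)).
transitivity (\sum_(x | A #|porbit shift x|) visits w s x).
  rewrite [RHS](bigID (fun x => #|porbit shift x| <= n)) /= [X in _ = _ + X]big1 ?addn0.
    by apply: eq_bigl => x; rewrite andbC.
  by move=> x /andP[_]; rewrite -ltnNge; exact: visits_long.
rewrite -[RHS]sum1_card [RHS](partition_big (itinerary w s) (fun x => A #|porbit shift x|)).
  apply: eq_bigr => x Ax; rewrite /visits -sum1_card; apply: eq_bigl => j.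
  rewrite !inE -(card_porbit_itinerary j cws).
  by case: (itinerary w s j =P x) => [->|]; rewrite ?Ax ?andbF.
by move=> j; rewrite inE card_porbit_itinerary.
Qed.

Lemma profile_multiset w s : compatible w s ->
  profile w s \in multisets n necklace (fun C => #|C|) n.
Proof.
move=> cws; apply/multisetsP; split=> [C nC|].
  by rewrite ffunE (negPf nC).
have := sum_profile predT cws; rewrite (eq_bigl necklace) => [|C]; last by rewrite andbT.
by move=> ->; rewrite -[RHS]card_ord; apply: eq_card => j; rewrite !inE.
Qed.

Lemma profile_type w s i : compatible w s -> 0 < i ->
  \sum_(C | necklace C && (#|C| == i)) profile w s C = ncycles i w.
Proof.
move=> cws i0; apply/eqP; rewrite -(eqn_pmul2r i0) ncycles_mul.
rewrite -(sum_profile (pred1 i) cws) mulnC big_distrr /=.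
by apply/eqP/eq_bigr => C /andP[_ /eqP->].
Qed.

Lemma profile_inj :
  {in compatible_pairs n k &, injective (fun p => profile p.1 p.2)}.
Proof.
move=> [w s] [w' s']; rewrite !inE /= => cws cws' e.
suff [-> ->] : w = w' /\ s = s' by [].
apply: compatible_determined => // x; case: (leqP #|porbit shift x| n) => nx; last first.
  by rewrite !visits_long.
have nC : necklace (porbit shift x) by rewrite /necklace imset_f.
by rewrite -!(profileE _ _ nC (porbit_id _ _)) e.
Qed.

Lemma necklace_divisor_sum j : 0 < j <= n ->
  weight_divisor_sum necklace (fun C => #|C|) j = k ^ j.
Proof.
move=> /andP[j0 jn]; rewrite /weight_divisor_sum.
rewrite -(card_shift_fixed k j0 (fact_gt0 n)) ?dvdn_fact ?j0 // -[RHS]sum1_card.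
transitivity (\sum_(C in porbits shift | (#|C| <= n) && (#|C| %| j)) \sum_(x in C) 1).
  by apply: eq_big => [C|C _]; rewrite ?andbA // sum1_card.
rewrite (sum_porbits _ (fun C => (#|C| <= n) && (#|C| %| j))); apply: eq_bigl => x.
rewrite inE -porbit_size_dvd andbC; case: (boolP (_ %| j)) => //= xj.
by rewrite (leq_trans (dvdn_leq j0 xj)).
Qed.

(** Surjectivity by counting: there are at least [k^n] compatible pairs, one for
    each word, and only [k^n] multisets of necklaces, so the injective map
    [profile] reaches them all. *)
Lemma profile_image : [set profile p.1 p.2 | p in compatible_pairs n k]
  = multisets n necklace (fun C => #|C|) n.
Proof.
apply/eqP; rewrite eqEcard; apply/andP; split.
  by apply/subsetP => _ /imsetP[p + ->]; rewrite inE; exact: profile_multiset.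
rewrite (card_in_imset profile_inj) (@card_multisets_exp _ _ _ _ necklace_gt0 k) //.
  exact: card_compatible_pairs_ge.
exact: necklace_divisor_sum.
Qed.

Lemma card_compatible_type c : \sum_(1 <= i < n.+1) i * c i = n ->
  #|[set p in compatible_pairs n k | has_cycle_type c p.1]|
  = \prod_(1 <= i < n.+1) 'C(#|[pred C | necklace C & #|C| == i]| + c i - 1, c i).
Proof.
move=> cn; have deg_le C : necklace C -> 0 < #|C| <= n.
  by move=> nC; rewrite necklace_gt0 //; case/andP: nC.
have c_le := multiplicity_le cn.
rewrite -(card_typed_multisets deg_le c_le).
rewrite -(card_in_imset (f := fun p => profile p.1 p.2)); last first.
  by move=> p p'; rewrite !inE => /andP[h _] /andP[h' _]; apply: profile_inj; rewrite inE.
apply: eq_card => f; apply/imsetP/idP => [[p pA ->]|fT].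
  have [cp /has_cycle_typeP cT] : compatible p.1 p.2 /\ has_cycle_type c p.1.
    by move: pA; rewrite !inE => /andP[].
  apply/typed_multisetsP; split=> [C nC|i iN].
    by rewrite ffunE (negPf nC).
  by rewrite profile_type ?cT //; case/andP: iN.
have := subsetP (typed_multisets_sub deg_le cn) f fT.
rewrite -profile_image => /imsetP[p cp ef]; exists p => //.
rewrite !inE in cp *; rewrite cp /=; apply/has_cycle_typeP => i iN.
rewrite -(profile_type cp); last by case/andP: iN.
by rewrite -ef; have [_ ->] := elimT (typed_multisetsP _ _ _ _) fT.
Qed.

End NecklaceProfiles.

(** * The Gessel-Reutenauer count by descents *)

Section CompatibleCount.
Local Open Scope nat_scope.
Variables (n k : nat) (w : 'S_n).
Implicit Type s : {ffun 'I_n -> 'I_k}.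

Lemma descent_atE (i j : 'I_n) : j = i.+1 :> nat -> descent_at w i = (w j < w i).
Proof.
move=> ji; apply/existsP/idP => [[l /andP[/eqP li]]|lt]; last first.
  by exists j; rewrite /= ji eqxx.
by rewrite (_ : l = j) //; apply: val_inj; rewrite li /= ji.
Qed.

Lemma descent_at_last (i : 'I_n) : i.+1 = n -> descent_at w i = false.
Proof.
move=> iN; apply/negbTE/existsP => -[j /andP[/eqP ji _]].
by have := ltn_ord j; rewrite -[nat_of_ord j]/(val j) ji iN ltnn.
Qed.

(** The relation between positions that defines compatibility is transitive, so
    it is enough to check it on consecutive positions. *)
Lemma compatible_adjP s :
  reflect (forall i j : 'I_n, j = i.+1 :> nat -> s i + descent_at w i <= s j)
          (compatible w s).
Proof.
apply: (iffP (compatibleP _ _)) => [h i j ji|h].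
  rewrite (descent_atE ji).
  have ij : i < j by rewrite ji.
  have [lt|[-> lt]] := h i j ij.
    by case: (_ < _); rewrite ?addn1 ?addn0 // ltnW.
  by rewrite ltnNge (ltnW lt) addn0.
have main d (i j : 'I_n) : j = i + d.+1 :> nat -> s i < s j \/ s i = s j /\ w i < w j.
  elim: d j => [|d IH] j ji.
    move: (h i j); rewrite ji addn1 => /(_ erefl).
    rewrite (@descent_atE i j) ?ji ?addn1 //; case: ltngtP => [lt|lt|/val_inj/perm_inj e].
    - by rewrite addn1; left.
    - rewrite addn0 leq_eqVlt => /orP[/eqP/val_inj e|]; by [right|left].
    - by move: ji; rewrite e; lia.
  have jn : i + d.+1 < n by apply: leq_trans (ltn_ord j); rewrite ji; lia.
  have := h (Ordinal jn) j; rewrite ji addnS => /(_ erefl).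
  rewrite (@descent_atE _ j) ?ji ?addnS //.
  case: (IH (Ordinal jn) erefl) => [lt|[-> lt]] le.
    by left; apply: (leq_trans lt); apply: leq_trans le; rewrite leq_addr.
  move: le; case: (ltngtP (w j) (w (Ordinal jn))) => [lt'|lt'|/val_inj/perm_inj e].
  - by rewrite addn1; left.
  - rewrite addn0 leq_eqVlt => /orP[/eqP/val_inj e|]; last by left.
    by right; split=> //; exact: ltn_trans lt'.
  - by move: ji; rewrite e /=; lia.
by move=> i j ij; apply: (main (j - i.+1)); lia.
Qed.

Let desc (t : nat) : bool := if insub t is Some i then @descent_at n w i else false.
Let before (t : nat) := \sum_(l < t) desc l.

Let desc_ord (i : 'I_n) : desc i = descent_at w i.
Proof. by rewrite /desc valK. Qed.

Let beforeS t : before t.+1 = before t + desc t.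
Proof. by rewrite /before big_ord_recr. Qed.

Let before_le t d : before (t + d) <= before t + d.
Proof.
elim: d => [|d IH]; first by rewrite !addn0.
rewrite !addnS beforeS; case: (desc _); lia.
Qed.

Let before_mono t d : before t <= before (t + d).
Proof. by elim: d => [|d IH]; rewrite ?addn0 // addnS beforeS; lia. Qed.

Let before_n : before n = des w.
Proof.
rewrite /des -sum1_card big_mkcond /=; apply: eq_bigr => i _.
by rewrite desc_ord inE; case: descent_at.
Qed.

(** Adding to [s i] the number of ascents before [i] makes the sequence strictly
    increasing with values below [n + k - 1 - des w], and every strictly
    increasing sequence with such values arises in this way. *)
Lemma card_compatible : 0 < n ->
  #|[set s : {ffun 'I_n -> 'I_k} | compatible w s]| = 'C(n + k - 1 - des w, n).
Proof.
move=> n0; have beforeN : before n.-1 = des w.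
  have lt : n.-1 < n by lia.
  rewrite -before_n -[in RHS](prednK n0) beforeS (desc_ord (Ordinal lt)).
  by rewrite descent_at_last ?addn0 //= prednK.
have before_t t : before t <= t.
  by have := before_le 0 t; rewrite /before big_ord0.
have D_le t : t < n -> t - before t <= n.-1 - des w.
  move=> tn; rewrite -beforeN; have := before_le t (n.-1 - t).
  by rewrite subnKC; [have := before_t t|]; lia.
have D_mono t : t < n -> before t <= des w.
  by move=> tn; rewrite -beforeN; have := before_mono t (n.-1 - t); rewrite subnKC //; lia.
have des_n : des w < n.
  by have := before_t n.-1; rewrite beforeN; lia.
case eN : (n + k - 1 - des w) => [|N].
  rewrite bin_small //; apply/eqP; rewrite cards_eq0; apply/eqP/setP => s; rewrite inE [RHS]inE.
  by have := ltn_ord (s (Ordinal n0)); lia.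
pose G s : n.-tuple 'I_N.+1 := [tuple inord (s i + (i - before i)) | i < n].
have GE s (i : 'I_n) : tnth (G s) i = s i + (i - before i) :> nat.
  rewrite tnth_mktuple inordK //; have := D_le i (ltn_ord i); have := ltn_ord (s i); lia.
have nthE (t : n.-tuple 'I_N.+1) (i : 'I_n) : nth 0 (map val t) i = tnth t i.
  by rewrite (nth_map ord0) ?size_tuple // (tnth_nth ord0).
have sortedE (t : n.-tuple 'I_N.+1) :
    reflect (forall i j : 'I_n, j = i.+1 :> nat -> tnth t i < tnth t j)
            (sorted ltn (map val t)).
  apply: (iffP (sortedP 0)) => [h i j ji|h i].
    by have := h i; rewrite size_map size_tuple -ji !nthE; apply; rewrite ltn_ord.
  rewrite size_map size_tuple => iN.
  by rewrite (nthE _ (Ordinal (ltnW iN))) (nthE _ (Ordinal iN)); exact: h.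
rewrite -card_ltn_sorted_tuples -(card_in_imset (f := G)); last first.
  move=> s s' _ _ e; apply/ffunP => i; apply: val_inj; apply: (@addIn (i - before i)).
  by rewrite -!GE e.
apply: eq_card => t; rewrite [RHS]inE; apply/imsetP/sortedE => [[s + ->] i j ji|ht].
  rewrite inE => /compatible_adjP/(_ i j ji); rewrite !GE ji beforeS -desc_ord.
  by have := before_t i; case: (desc i); lia.
have t_ge (i j : 'I_n) d : j = i + d :> nat -> tnth t i + d <= tnth t j.
  elim: d j => [|d IH] j ji.
    by rewrite addn0 (_ : j = i) //; apply: val_inj; rewrite /= ji addn0.
  have jn : i + d < n by apply: leq_ltn_trans (ltn_ord j); rewrite ji; lia.
  have := ht (Ordinal jn) j; rewrite ji addnS => /(_ erefl) lt.
  by rewrite addnS; apply: leq_ltn_trans lt; exact: IH.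
have t_lo (i : 'I_n) : i <= tnth t i.
  by have := t_ge (Ordinal n0) i i; rewrite /= add0n => /(_ erefl); lia.
have lastP : n.-1 < n by lia.
have t_hi (i : 'I_n) : tnth t i - (i - before i) < k.
  have := t_ge i (Ordinal lastP) (n.-1 - i); rewrite /= subnKC; last first.
    by have := ltn_ord i; lia.
  move=> /(_ erefl); have := ltn_ord (tnth t (Ordinal lastP)).
  have := D_mono i (ltn_ord i); have := before_t i; have := ltn_ord i; have := t_lo i.
  move: (nat_of_ord (tnth t i)) (nat_of_ord (tnth t (Ordinal lastP))) => a b.
  lia.
exists [ffun i => Ordinal (t_hi i)]; last first.
  apply: eq_from_tnth => i; apply: val_inj; rewrite /= GE ffunE /= subnK //.
  by apply: leq_trans (t_lo i); rewrite leq_subr.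
rewrite inE; apply/compatible_adjP => i j ji; rewrite !ffunE /= -desc_ord.
have := ht i j ji; have := t_lo i; have := before_t i.
rewrite ji beforeS; case: (desc i);
  move: (nat_of_ord (tnth t i)) (nat_of_ord (tnth t j)) => a b; lia.
Qed.

End CompatibleCount.

(** Both sides count the compatible pairs [(w, s)] with [w] of cycle type [c]:
    the left one permutation by permutation, the right one through
    [profile]. *)
Theorem gessel_reutenauer (n k : nat) (c f : nat -> nat) : (0 < n)%N ->
  (\sum_(1 <= i < n.+1) i * c i)%N = n ->
  (forall i, (0 < i <= n)%N -> (f i)%:R =
     i%:R^-1 * \sum_(d <- divisors i) (moebius d)%:~R * k%:R ^+ (i %/ d) :> rat) ->
  (\sum_(w : 'S_n | has_cycle_type c w) 'C(n + k - 1 - des w, n)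
   = \prod_(1 <= i < n.+1) 'C(f i + c i - 1, c i))%N.
Proof.
move=> n0 cn fE.
transitivity #|[set p in compatible_pairs n k | has_cycle_type c p.1]|.
  rewrite -sum1_card (partition_big (fun p => p.1) (has_cycle_type c)) /=; last first.
    by move=> p; rewrite inE => /andP[].
  apply: eq_bigr => w wc; rewrite -card_compatible // -sum1_card.
  rewrite (reindex_onto (fun s => (w, s)) snd) /=.
    by apply: eq_bigl => s; rewrite !inE wc !eqxx !andbT.
  by move=> [w' s] /andP[_ /= /eqP->].
rewrite card_compatible_type //; apply: eq_big_nat => i iN.
congr 'C(_ + _ - 1, _); apply/eqP; rewrite -(@eqr_nat rat) fE //.
have := @weight_count_moebius _ n k _ _ (@necklace_gt0 n k) (@necklace_divisor_sum n k) i iN.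
by move=> <-.
Qed.

(** * From descents to cyclic descents *)

Section CyclicDescents.
Local Open Scope nat_scope.
Variable m' : nat.
Local Notation m := m'.+2.
Implicit Types (w : 'S_m) (a b x j : 'I_m).

(** A comparison is the carry of a subtraction modulo [m]. This turns counts of
    descents into sums of residues, which are easy to reindex. *)
Lemma val_sub_mod a b : (b - a)%R + a = b + m * (b < a) :> nat.
Proof.
have am := ltn_ord a; have bm := ltn_ord b.
rewrite /= modnDmr; case: (ltnP b a) => ab.
  rewrite muln1 modn_small; lia.
rewrite muln0 addn0 (_ : b + (m - a) = m + (b - a)); last lia.
by rewrite modnDl modn_small; lia.
Qed.

Lemma val_pred_mod a : (a - 1)%R + 1 = a + m * (a == 0%R) :> nat.
Proof.
have v1 : (1%R : 'I_m) = 1 :> nat by rewrite /= modn_small.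
have := val_sub_mod 1%R a; rewrite v1 => ->.
by rewrite ltnS leqn0 -val_eqE.
Qed.

Lemma val_add1 x : (x + 1)%R = (if x.+1 == m then 0 else x.+1) :> nat.
Proof.
have xm := ltn_ord x; rewrite /= (@modn_small 1) // addn1.
by case: eqP => [->|h]; rewrite ?modnn // modn_small //; lia.
Qed.

Lemma cdes_sum w : cdes w = \sum_x (w (x + 1)%R < w x).
Proof.
have dE x : x.+1 != m -> @descent_at m w x = (w (x + 1)%R < w x).
  by move=> xm; apply: descent_atE; rewrite val_add1 (negPf xm).
have dmax : @descent_at m w ord_max = false by exact: descent_at_last.
have cE : cyclic_descent w = (w (ord_max + 1)%R < w ord_max).
  apply/existsP/idP => [[i /existsP[j /and3P[/eqP im /eqP j0 lt]]]|lt].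
    have <- : i = ord_max by apply: val_inj; case: im.
    by rewrite (_ : (i + 1)%R = j) //; apply: val_inj; rewrite j0; apply: etrans (val_add1 i) _; rewrite im eqxx.
  exists ord_max; apply/existsP; exists (ord_max + 1)%R; apply/and3P; split=> //.
  by apply/eqP; apply: etrans (val_add1 ord_max) _; rewrite eqxx.
have desE : des w = \sum_(x | x != ord_max) (w (x + 1)%R < w x).
  rewrite /des -sum1_card big_mkcond (bigD1 ord_max) //= inE dmax add0n.
  apply: eq_bigr => x xm; rewrite inE dE; first by case: (_ < _).
  by apply: contra xm => /eqP[xm]; apply/eqP/val_inj.
by rewrite /cdes (bigD1 ord_max) //= -desE -cE; case: cyclic_descent.
Qed.

(** Around the circle the differences [w (x + 1) - w x] cancel, so the sum of
    their residues is [m] times the number of carries. Rotating positions or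
    values visibly preserves this sum. *)
Lemma mul_cdes w : m * cdes w = \sum_x (w (x + 1)%R - w x)%R.
Proof.
(* Adding the sum of [w x] to both sides avoids integer subtraction. *)
apply: (@addIn (\sum_x w x)); rewrite -big_split /=.
under [RHS]eq_bigr => x _ do rewrite val_sub_mod.
rewrite big_split /= -big_distrr /= -cdes_sum addnC; congr (_ + _).
by rewrite [LHS](reindex_inj (addIr 1%R)).
Qed.

Lemma cdes_bounds w : 0 < cdes w < m.
Proof.
have pos x : 0 < (w (x + 1)%R - w x)%R.
  rewrite lt0n; apply/negP => /eqP h.
  have /eqP : (w (x + 1) - w x)%R = 0%R by apply: val_inj.
  by rewrite subr_eq0 => /eqP/perm_inj/eqP; rewrite -subr_eq0 addrC addKr.
apply/andP; split.
  rewrite -(ltn_pmul2l (ltn0Sn m'.+1)) mul_cdes muln0.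
  by rewrite (bigD1 ord0) //; apply: ltn_addr; exact: pos.
rewrite -(ltn_pmul2l (ltn0Sn m'.+1)) mul_cdes.
apply: (@leq_ltn_trans (\sum_(x : 'I_m) m'.+1)).
  by apply: leq_sum => x _; rewrite -ltnS ltn_ord.
by rewrite sum_nat_const card_ord ltn_pmul2l.
Qed.

Definition translation j : 'S_m := perm (addIr j).

Definition translate w j : 'S_m := (w ^ translation j)%g.

Lemma translateE w j x : translate w j x = (w (x - j) + j)%R.
Proof.
have -> : x = translation j (x - j)%R by rewrite permE subrK.
by rewrite permJ !permE addrK.
Qed.

Lemma cdes_translate w j : cdes (translate w j) = cdes w.
Proof.
apply/eqP; rewrite -(eqn_pmul2l (ltn0Sn m'.+1)) !mul_cdes; apply/eqP.
rewrite [LHS](reindex_inj (addIr j)); apply: eq_bigr => x _.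
rewrite !translateE (_ : (x + j + 1 - j)%R = (x + 1)%R); last by rewrite addrAC addrK.
by rewrite addrK opprD addrACA subrr addr0.
Qed.

Lemma ncycles1 w : ncycles 1 w = \sum_x (w x == x).
Proof.
rewrite -[LHS]muln1 ncycles_mul -sum1_card big_mkcond; apply: eq_bigr => x _.
by rewrite inE -dvdn1 porbit_size_dvd expg1; case: eqP.
Qed.

(** The translates of [w] with a cyclic descent at the last position number
    [cdes w - 1 + ncycles 1 w]. Indeed the translate that brings positions [p]
    and [p + 1] to the two ends has a cyclic descent there when subtracting
    [w p - (p + 1)] from [w (p + 1) - (p + 1)] produces a carry; over all [p],
    the residues of [w p - p] cancel up to a correction for each fixed point
    of [w]. *)
Lemma sum_cyclic_descent w :
  (\sum_j cyclic_descent (translate w j)).+1 = cdes w + ncycles 1 w.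
Proof.
have cE (u : 'S_m) : cyclic_descent u = (u 0%R < u (- 1)%R) :> bool.
  have N1 : (- 1)%R = ord_max :> 'I_m.
    by apply: val_inj; rewrite /= [1 %% _]modn_small // subn1 modn_small.
  apply/existsP/idP => [[i /existsP[j /and3P[/eqP im /eqP j0 lt]]]|lt].
    have iE : i = ord_max by apply: val_inj; case: im.
    have jE : j = 0%R by apply: val_inj.
    by move: lt; rewrite iE jE -N1.
  by exists ord_max; apply/existsP; exists 0%R; apply/and3P; split=> //; rewrite -N1.
pose z p := (w p - p)%R.
have step p : m * cyclic_descent (translate w (- (p + 1))) + z (p + 1)%R
    = (w (p + 1) - w p)%R + (z p - 1)%R.
  rewrite cE !translateE !opprK add0r (addrC (-1)%R) addrK addnC.
  rewrite -val_sub_mod; congr (_ + _); congr nat_of_ord; rewrite /z.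
    by rewrite opprB addrA subrK.
  by rewrite opprD addrA.
have H1 : m * (\sum_j cyclic_descent (translate w j)) + \sum_p z p
    = m * cdes w + \sum_p (z p - 1)%R.
  rewrite mul_cdes -big_split big_distrr /=.
  (* Translate by [- (p + 1)]: this brings [p] and [p + 1] to the two ends. *)
  rewrite [X in X + _](reindex_inj (inj_comp oppr_inj (addIr 1%R))) /=.
  rewrite [X in _ + X](reindex_inj (addIr 1%R)) -big_split.
  by apply: eq_bigr => p _; exact: step.
have H2 : \sum_p (z p - 1)%R + m = \sum_p z p + m * ncycles 1 w.
  transitivity (\sum_p (z p - 1)%R + \sum_(p : 'I_m) 1).
    by rewrite [X in _ = _ + X]sum1_card card_ord.
  rewrite ncycles1 big_distrr -!big_split; apply: eq_bigr => p _.
  by apply: etrans (val_pred_mod _) _; rewrite subr_eq0.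
apply/eqP; rewrite -(eqn_pmul2l (ltn0Sn m'.+1)) mulnS mulnDr.
by move: H1 H2; rewrite -!/m; move: (m * _) (m * _) (m * _) => x y t; lia.
Qed.

(** All translates have the same [cdes], so [des] takes only the values [cdes w]
    and [cdes w - 1], how often being known from [sum_cyclic_descent]; the rest
    is Pascal's rule and absorption. *)
Lemma sum_translates k w : 0 < k ->
  \sum_j 'C(m + k - 1 - des (translate w j), m)
  = (k - 1 + ncycles 1 w) * 'C(m + k - 1 - cdes w, m - 1).
Proof.
move=> k0; have /andP[c0 cm] := cdes_bounds w.
set c := cdes w in c0 cm *; pose D := \sum_j cyclic_descent (translate w j).
have DE : D.+1 = c + ncycles 1 w by exact: sum_cyclic_descent.
have desE j : des (translate w j) = c - cyclic_descent (translate w j).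
  have : cdes (translate w j) = c by exact: cdes_translate.
  by rewrite {1}/cdes; case: cyclic_descent => <-; rewrite ?subn0 ?subn1.
pose A := 'C(m + k - 1 - c, m); pose B := 'C(m + k - 1 - c, m - 1).
have term j : 'C(m + k - 1 - des (translate w j), m)
    = A + cyclic_descent (translate w j) * B.
  rewrite desE; case: cyclic_descent; last by rewrite subn0 mul0n addn0.
  rewrite mul1n (_ : m + k - 1 - (c - true) = (m + k - 1 - c).+1); last lia.
  by rewrite binS /A /B subn1.
rewrite (eq_bigr _ (fun j _ => term j)) big_split /= sum_nat_const card_ord.
rewrite -big_distrl /= -/D.
have mA : m * A = (k - c) * B.
  rewrite /A /B subn1 mul_bin_left; case: (leqP c k) => ck.
    by congr (_ * _); lia.
  rewrite bin_small ?muln0 //; lia.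
rewrite mA; case: (leqP c k) => ck.
  by rewrite -mulnDl; congr (_ * _); lia.
have B0 : B = 0 by rewrite /B bin_small //; lia.
by rewrite -/B B0 !muln0.
Qed.

End CyclicDescents.

(** Conjugating by a rotation permutes a conjugacy class, so averaging over the
    rotations does not change the sum over a cycle type. The case [n = 1] is
    apart: rotations are trivial and there is no cyclic descent. *)
Lemma cyclic_linear_descents (n k : nat) (c : nat -> nat) : (0 < n)%N -> (0 < k)%N ->
  (n * (\sum_(w : 'S_n | has_cycle_type c w) 'C(n + k - 1 - des w, n))
  = (k - 1 + c 1) *
    \sum_(w : 'S_n | has_cycle_type c w) 'C(n + k - 1 - cdes w, n - 1))%N.
Proof.
case: n => [//|[|m']] _ k0.
  rewrite mul1n big_distrr /=; apply: eq_bigr => w /has_cycle_typeP wc.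
  have := sum_ncycles w; rewrite big_nat1 mul1n wc // => ->.
  have d0 : des w = 0%N.
    apply/eqP; rewrite cards_eq0; apply/eqP/setP => i; rewrite !inE.
    by apply: descent_at_last; case: i => -[].
  have cd0 : cyclic_descent w = false.
    by apply/negbTE/existsP => -[i /existsP[j /and3P[_ _]]]; rewrite !ord1.
  by rewrite /cdes cd0 d0 subnn bin0 bin1; lia.
rewrite -[X in (X * _)%N]card_ord -sum_nat_const.
transitivity (\sum_(j < m'.+2) \sum_(w : 'S_m'.+2 | has_cycle_type c w)
   'C(m'.+2 + k - 1 - des (translate w j), m'.+2))%N.
  apply: eq_bigr => j _; rewrite (reindex_inj (conjg_inj (translation j))) /=.
  apply: eq_bigl => w; apply/has_cycle_typeP/has_cycle_typeP => h i iN.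
    by rewrite -(h i iN) ncyclesJ //; case/andP: iN.
  by rewrite -(h i iN) ncyclesJ //; case/andP: iN.
rewrite exchange_big big_distrr /=; apply: eq_bigr => w /has_cycle_typeP wc.
by rewrite sum_translates // wc.
Qed.

(** The factor [k - 1 + c 1] is exactly what turns the choice of [c 1] letters
    out of [k] into a choice out of [k - 1], which is the difference between the
    exponents [M] and the numbers of primitive necklaces. *)
Theorem cyclic_descent_cycle_type (n k : nat) (c M : nat -> nat) :
  (0 < n)%N -> (2 <= k)%N -> (\sum_(1 <= i < n.+1) i * c i)%N = n ->
  (forall i, (0 < i <= n)%N -> (M i)%:R =
     i%:R^-1 * \sum_(d <- divisors i) (moebius d)%:~R * (k%:R ^+ (i %/ d) - 1) :> rat) ->
  ((k - 1) * \sum_(w : 'S_n | has_cycle_type c w) 'C(n + k - 1 - cdes w, n - 1)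
   = n * \prod_(1 <= i < n.+1) 'C(M i + c i - 1, c i))%N.
Proof.
move=> n0 k2 cn ME; have k0 : (0 < k)%N by apply: ltnW.
pose f i := (M i + (i == 1))%N.
have fE i : (0 < i <= n)%N -> (f i)%:R =
     i%:R^-1 * \sum_(d <- divisors i) (moebius d)%:~R * k%:R ^+ (i %/ d) :> rat.
  move=> iN; have i0 : (0 < i)%N by case/andP: iN.
  rewrite natrD ME //; under eq_bigr => d _ do rewrite mulrBr mulr1.
  rewrite sumrB -rmorph_sum /= sum_moebius // mulrBr.
  by case: eqP => [->|_]; rewrite ?mulr0 ?subr0 ?addr0 // invr1 !mul1r subrK.
have M1 : M 1%N = (k - 1)%N.
  apply/eqP; rewrite -(@eqr_nat rat) ME ?n0 // (_ : divisors 1 = [:: 1%N]) //.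
  by rewrite big_seq1 divn1 invr1 !mul1r expr1 natrB.
have GR := gessel_reutenauer n0 cn fE; have CL := cyclic_linear_descents c n0 k0.
rewrite GR in CL; have pos : (0 < k - 1 + c 1)%N by lia.
apply/eqP; rewrite -(eqn_pmul2l pos) mulnCA -CL mulnCA [X in _ == X]mulnCA.
rewrite eqn_pmul2l // !(big_ltn (m := 1)) // !mulnA; apply/eqP; congr (_ * _)%N.
  rewrite /f M1 eqxx (_ : k - 1 + 1 + c 1 - 1 = k - 1 + c 1)%N; last lia.
  by have := mul_bin_down (k - 1 + c 1) (c 1); rewrite addnK -subn1 => ->.
rewrite big_nat_cond [RHS]big_nat_cond; apply: eq_bigr => i /andP[/andP[i1 _] _].
by rewrite /f (gtn_eqF i1) addn0.
Qed.

(** * Coefficients of formal power series *)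

Lemma necklace_number_exists (k : nat) : (0 < k)%N ->
  {M : nat -> nat | forall i, (0 < i)%N -> (M i)%:R =
     i%:R^-1 * \sum_(d <- divisors i) (moebius d)%:~R * (k%:R ^+ (i %/ d) - 1) :> rat}.
Proof.
move=> k0; pose f i := #|[pred C | @necklace i k C & #|C| == i]|.
have fE i : (0 < i)%N -> (f i)%:R =
     i%:R^-1 * \sum_(d <- divisors i) (moebius d)%:~R * k%:R ^+ (i %/ d) :> rat.
  move=> i0; apply: (@weight_count_moebius _ i k _ _ (@necklace_gt0 i k)
    (@necklace_divisor_sum i k)); by rewrite i0 leqnn.
have f1 : f 1%N = k.
  apply/eqP; rewrite -(@eqr_nat rat) fE // (_ : divisors 1 = [:: 1%N]) //.
  by rewrite big_seq1 divn1 invr1 !mul1r expr1.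
exists (fun i => f i - (i == 1))%N => i i0.
rewrite natrB; last by case: eqP => // ->; rewrite f1.
under eq_bigr => d _ do rewrite mulrBr mulr1.
rewrite fE // sumrB -rmorph_sum /= sum_moebius // mulrBr; congr (_ - _).
by case: eqP => [->|_]; rewrite ?mulr0 // invr1 mul1r.
Qed.

Section MonomialWeights.
Local Open Scope nat_scope.
Implicit Types (m : monomial) (N j e : nat).

Lemma weight_ge m j : j.+1 * m j <= weight m.
Proof.
rewrite /weight; have [jm|] := boolP (j \in finsupp m).
  by rewrite (big_rem j) //= leq_addr.
by rewrite msuppE => /mset_eq0P->; rewrite muln0.
Qed.

Lemma weight_bound m j : weight m <= j -> m j = 0.
Proof.
by move=> h; apply/eqP; rewrite -leqn0 -ltnS; have := weight_ge m j; nia.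
Qed.

Lemma weightE m N : (forall j, N <= j -> m j = 0) ->
  weight m = \sum_(1 <= i < N.+1) i * m i.-1.
Proof.
move=> mN; rewrite big_add1 /= /weight.
rewrite [RHS](bigID (fun j => j \in finsupp m)) /= [X in _ = _ + X]big1 ?addn0; last first.
  by move=> j; rewrite msuppE => /mset_eq0P->; rewrite muln0.
rewrite -[RHS]big_filter; apply/perm_big/uniq_perm; rewrite ?fset_uniq //.
  by rewrite filter_uniq ?iota_uniq.
move=> j; rewrite mem_filter mem_index_iota /= -[LHS]andbT.
case: (boolP (j \in finsupp m)) => //= jm; apply/esym; rewrite ltnNge.
by apply/negP => /mN/eqP; rewrite mset_eq0 -msuppE jm.
Qed.

End MonomialWeights.

Section FpsCoefficients.
Implicit Types (f g : fps) (m a b : monomial).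

Lemma fps_sumE (I : Type) (r : seq I) (P : pred I) (F : I -> fps) m :
  (\sum_(i <- r | P i) F i) m = \sum_(i <- r | P i) F i m.
Proof. exact: (big_morph (fun f : fps => f m)). Qed.

Lemma fps_mulE f g m : (f * g) m = \sum_(x <- mdivisors m) f x * g (m `\` x)%mset.
Proof. by []. Qed.

Definition fps_mono a : fps := fun m => (m == a)%:R.

Lemma fps_monoM a b : fps_mono a * fps_mono b = fps_mono (a `+` b)%mset.
Proof.
apply/funext => m; rewrite fps_mulE /fps_mono.
have [am|nam] := boolP (a `<=` m)%mset.
  rewrite (bigD1_seq a) ?mdivisors_uniq ?mem_mdivisors //= eqxx mul1r.
  rewrite big1 ?addr0 => [|x /negPf->]; last by rewrite mul0r.
  suff -> : ((m `\` a)%mset == b) = (m == (a `+` b)%mset) by [].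
  by apply/eqP/eqP => [<-|->]; rewrite ?msetBDKC // msetDKB.
rewrite big_seq big1 => [|x]; last first.
  rewrite mem_mdivisors => xm; case: eqP => [xa|]; last by rewrite mul0r.
  by rewrite -xa xm in nam.
case: eqP => // mE; case/negP: nam; rewrite mE.
by apply/msubsetP => i; rewrite msetE2 leq_addr.
Qed.

Lemma indetXE i e : indet i ^+ e = fps_mono (msetn e i.-1).
Proof.
elim: e => [|e IH]; first by rewrite expr0 msetn0.
rewrite exprS IH (fps_monoM [mset i.-1]%mset); congr fps_mono.
by apply/msetP => j; rewrite msetE2 !msetnE; case: eqP.
Qed.

Lemma prod_indetE (N : nat) (e : nat -> nat) m :
  (\prod_(1 <= i < N.+1) indet i ^+ e i) m
  = `[< forall j, m j = if (j < N)%N then e j.+1 else 0%N >]%:R.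
Proof.
suff [a [-> aE]] : exists a : monomial,
    \prod_(1 <= i < N.+1) indet i ^+ e i = fps_mono a /\
    forall j, a j = if (j < N)%N then e j.+1 else 0%N.
  rewrite /fps_mono; suff <- : (m == a) =
    `[< forall j, m j = if (j < N)%N then e j.+1 else 0%N >] by [].
  by apply/eqP/asboolP => [-> //|h]; apply/msetP => j; rewrite h aE.
elim: N => [|N [a [IH aE]]].
  by exists mset0; rewrite big_geq //; split=> // j; rewrite mset0E.
exists (a `+` msetn (e N.+1) N)%mset; split.
  by rewrite big_nat_recr //= IH indetXE fps_monoM.
move=> j; rewrite msetE2 aE msetnE [(j < N.+1)%N]ltnS [(j <= N)%N]leq_eqVlt.
by case: eqP => [->|_]; rewrite ?ltnn ?addn0.
Qed.

(** When [g i] only involves [a_i], a monomial splits in a single way between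
    the factors of the product: the only contribution to the coefficient of [m]
    in the last product takes all of the last indeterminate from the last
    factor. *)
Lemma prod_univariate (N : nat) (g : nat -> fps) (u : nat -> nat -> rat) :
  (forall i m, (0 < i <= N)%N ->
     g i m = if m == msetn (m i.-1) i.-1 then u i (m i.-1) else 0) ->
  forall m, (forall j, (N <= j)%N -> m j = 0%N) ->
  (\prod_(1 <= i < N.+1) g i) m = \prod_(1 <= i < N.+1) u i (m i.-1).
Proof.
move=> gE.
suff main m : (\prod_(1 <= i < N.+1) g i) m =
    if `[< forall j, (N <= j)%N -> m j = 0%N >]
    then \prod_(1 <= i < N.+1) u i (m i.-1) else 0.
  by move=> m mN; rewrite main; case: asboolP.
elim: N gE m => [|N IH] gE m.
  rewrite !big_geq //; rewrite {1}/GRing.one /= /fps_one; case: asboolP => h.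
    by rewrite (_ : m = mset0) ?eqxx //; apply/msetP => j; rewrite h // mset0E.
  by case: eqP => // m0; case: h => j _; rewrite m0 mset0E.
have -> : \prod_(1 <= i < N.+2) g i = (\prod_(1 <= i < N.+1) g i) * g N.+1.
  by rewrite big_nat_recr.
have -> : \prod_(1 <= i < N.+2) u i (m i.-1)
    = (\prod_(1 <= i < N.+1) u i (m i.-1)) * u N.+1 (m N) by rewrite big_nat_recr.
rewrite fps_mulE.
pose b : monomial := msetn (m N) N; pose a : monomial := (m `\` b)%mset.
have bm : (b `<=` m)%mset.
  by apply/msubsetP => j; rewrite msetnE; case: eqP => // ->.
have am : (a `<=` m)%mset by apply/msubsetP => j; rewrite msetE2 leq_subr.
have aE j : a j = if j == N then 0%N else m j.
  by rewrite msetE2 msetnE; case: eqP => [->|_]; rewrite ?subnn ?subn0.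
have {}IH x : (\prod_(1 <= i < N.+1) g i) x =
    if `[< forall j, (N <= j)%N -> x j = 0%N >]
    then \prod_(1 <= i < N.+1) u i (x i.-1) else 0.
  apply: IH => i y /andP[i0 iN]; apply: gE; by rewrite i0 (leq_trans iN).
rewrite (bigD1_seq a) ?mdivisors_uniq ?mem_mdivisors //= [X in _ + X]big_seq_cond.
rewrite [X in _ + X]big1.
  rewrite addr0 IH (_ : m `\` a = b)%mset; last by rewrite msetBBK.
  rewrite gE ?leqnn //= /b msetnxx eqxx.
  have -> : `[< forall j, (N <= j)%N -> a j = 0%N >]
          = `[< forall j, (N.+1 <= j)%N -> m j = 0%N >].
    apply/asboolP/asboolP => h j Nj.
      by have := h j (ltnW Nj); rewrite aE gtn_eqF.
    by rewrite aE; case: eqP => // /eqP jN; apply: h; rewrite ltn_neqAle eq_sym jN.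
  case: asboolP => _; last by rewrite mul0r.
  congr (_ * _); apply: eq_big_nat => i /andP[i1 iN].
  by rewrite aE ltn_eqF //; lia.
move=> x /andP[]; rewrite mem_mdivisors => /msubsetP xm xa.
rewrite IH; case: asboolP => xN; last by rewrite mul0r.
rewrite gE ?leqnn //=; case: eqP => mx; last by rewrite mulr0.
case/eqP: xa; apply/msetP => j; rewrite aE; case: eqP => [->|jN]; first exact: xN.
have := congr1 (fun y : monomial => y j) mx; rewrite /= msetE2 msetnE.
move/eqP: jN => /negPf->; have := xm j.
by move: (x j) (m j) => y z; lia.
Qed.

Lemma scaled_indetXE (c : rat) i e m :
  ((c *: indet i) ^+ e) m = c ^+ e * (m == msetn e i.-1)%:R.
Proof.
suff -> : (c *: indet i) ^+ e = c ^+ e *: indet i ^+ e by rewrite indetXE.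
elim: e => [|e IH]; first by rewrite !expr0 scale1r.
by rewrite !exprS IH -scalerAl mulrC -scalerAl scalerA mulrC [indet i * _]mulrC.
Qed.

Lemma fps_powr_indet (q alpha : rat) i m : (0 < i)%N ->
  fps_powr (1 - q *: indet i) alpha m =
  if m == msetn (m i.-1) i.-1
  then gbinom alpha (m i.-1) * (- q) ^+ m i.-1 else 0.
Proof.
move=> i0; rewrite /fps_powr.
have -> : 1 - q *: indet i - 1 = (- q) *: indet i.
  by rewrite addrAC subrr add0r scaleNr.
under eq_bigr => j _ do rewrite scaled_indetXE.
case: ifP => [/eqP mE|/eqP nm].
  have lt : (m i.-1 < (weight m).+1)%N.
    by rewrite ltnS (leq_trans _ (weight_ge m i.-1)) // leq_pmull.
  rewrite (bigD1 (Ordinal lt)) //= -mE eqxx mulr1 big1 ?addr0 // => j jn.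
  rewrite (_ : (m == msetn j i.-1) = false) ?mulr0 //.
  apply/eqP => mj; case/eqP: jn; apply: val_inj => /=.
  by have := congr1 (fun y : monomial => y i.-1) mj; rewrite /= msetnxx => ->.
rewrite big1 // => j _; case: eqP => [mj|]; last by rewrite !mulr0.
by case: nm; rewrite {2}mj msetnxx.
Qed.

(** The coefficients of [(1 - q x)^(-M)]. The truncated subtraction is correct
    also when [M = 0], where the series is [1]. *)
Lemma gbinom_neg (M e : nat) (q : rat) :
  gbinom (- M%:R) e * (- q) ^+ e = 'C(M + e - 1, e)%:R * q ^+ e.
Proof.
have main : \prod_(l < e) (M%:R + l%:R) = ('C(M + e - 1, e) * e`!)%:R :> rat.
  elim: e => [|e IH]; first by rewrite big_ord0 bin0.
  rewrite big_ord_recr /= IH -natrD -natrM; congr (_%:R).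
  rewrite factS mulnA [RHS](_ : _ = e.+1 * 'C(M + e.+1 - 1, e.+1) * e`!)%N; last lia.
  rewrite mulnAC; congr (_ * _)%N; rewrite addnS subn1 /=.
  case: M IH => [|M] _.
    by rewrite !add0n; case: e => [//|e]; rewrite subn1 /= !bin_small // muln0.
  by rewrite addSn -mul_bin_diag subn1 mulnC.
rewrite /gbinom (eq_bigr (fun l : 'I_e => - (M%:R + l%:R))); last first.
  by move=> l _; rewrite opprD.
rewrite prodrN card_ord main natrM mulrA mulfK; last by rewrite pnatr_eq0 -lt0n fact_gt0.
by rewrite mulrAC -exprMn mulN1r opprK mulrC.
Qed.

End FpsCoefficients.

(** * The cycle generating function *)

Section GeneratingFunction.
Variables (k : nat) (M : nat -> nat).
Hypothesis k_ge2 : (2 <= k)%N.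
Hypothesis ME : forall i, (0 < i)%N -> (M i)%:R =
  i%:R^-1 * \sum_(d <- divisors i) (moebius d)%:~R * (k%:R ^+ (i %/ d) - 1) :> rat.

Let k_neq0 : (k%:R : rat) != 0.
Proof. by rewrite pnatr_eq0; lia. Qed.

Let k1_neq0 : (k%:R - 1 : rat) != 0.
Proof. by rewrite subr_eq0 pnatr_eq1; lia. Qed.

Definition necklace_multisets (m : monomial) : nat :=
  (\prod_(1 <= i < (weight m).+1) 'C(M i + m i.-1 - 1, m i.-1))%N.

(** The Euler product of the theorem, described by its coefficients. *)
Definition necklace_series : fps :=
  fun m => (necklace_multisets m)%:R * k%:R ^- weight m.

(** The factors beyond the weight of [m] contribute a factor [1] to its
    coefficient, so the partial products are constant from there on. *)
Lemma euler_product_lim :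
  fps_lim
    (fun N => \prod_(1 <= i < N.+1)
       fps_powr (1 - (k%:R ^+ i)^-1 *: indet i)
         (- ((i%:R)^-1 * \sum_(d <- divisors i)
               (moebius d)%:~R * (k%:R ^+ (i %/ d)%N - 1))))
    necklace_series.
Proof.
move=> d; exists d => N m dN md.
pose u i e : rat := 'C(M i + e - 1, e)%:R * (k%:R ^+ i)^-1 ^+ e.
rewrite (@prod_univariate N _ u) => [|i m' /andP[i0 _]|j Nj]; last first.
- by apply: weight_bound; rewrite md (leq_trans dN).
- by rewrite fps_powr_indet // -ME // gbinom_neg.
rewrite (@big_cat_nat _ _ _ d.+1) //= [X in _ * X]big_nat [X in _ * X]big1 ?mulr1.
  rewrite big_split /= /necklace_series /necklace_multisets natr_prod md; congr (_ * _).
  transitivity (\prod_(1 <= i < d.+1) (k%:R : rat) ^- (i * m i.-1)).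
    by apply: eq_bigr => i _; rewrite exprVn exprM.
  have E : weight m = (\sum_(1 <= i < d.+1) i * m i.-1)%N.
    by apply: weightE => j dj; apply: weight_bound; rewrite md.
  by rewrite prodfV -(big_morph _ (exprD (k%:R : rat)) (expr0 _)) -E md.
move=> i /andP[di _]; have -> : m i.-1 = 0%N by apply: weight_bound; rewrite md; lia.
by rewrite /u bin0 expr0 mulr1.
Qed.

Lemma type_of_monomial n (w : 'S_n) (m : monomial) :
  `[< forall j, m j = if (j < n)%N then ncycles j.+1 w else 0%N >]
  = (weight m == n) && has_cycle_type (fun i => m i.-1) w.
Proof.
apply/asboolP/andP => [mE|[/eqP mn /has_cycle_typeP wm] j].
  have mn j : (n <= j)%N -> m j = 0%N by move=> nj; rewrite mE ltnNge nj.
  split; last by apply/has_cycle_typeP => i /andP[i0 iN] /=; rewrite mE (prednK i0) iN.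
  rewrite (weightE mn) -[X in _ == X](sum_ncycles w); apply/eqP/eq_big_nat => i.
  by move=> /andP[i0]; rewrite ltnS => iN; rewrite mE (prednK i0) iN.
case: ltnP => jn; first by rewrite wm.
by apply: weight_bound; rewrite mn.
Qed.

(** The permutations contributing to the monomial [m] are those whose cycle type
    is [m], and these exist only in the symmetric group of degree
    [weight m]. *)
Lemma cycle_series_coef n (m : monomial) :
  (\sum_(w : 'S_n.+1)
     ((n.+1%:R * k%:R ^+ n.+1)^-1 * 'C(n + k - cdes w, n)%N%:R) *:
       \prod_(1 <= i < n.+2) indet i ^+ ncycles i w) m
  = if weight m == n.+1 then (k%:R - 1)^-1 * necklace_series m else 0.
Proof.
rewrite fps_sumE.
transitivity (\sum_(w : 'S_n.+1) if (weight m == n.+1) && has_cycle_type (fun i => m i.-1) w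
   then (n.+1%:R * k%:R ^+ n.+1)^-1 * 'C(n + k - cdes w, n)%:R else 0 : rat).
  apply: eq_bigr => w _; rewrite -type_of_monomial.
  have E : (((n.+1%:R * k%:R ^+ n.+1)^-1 * 'C(n + k - cdes w, n)%N%:R) *:
       \prod_(1 <= i < n.+2) indet i ^+ ncycles i w) m
    = (n.+1%:R * k%:R ^+ n.+1)^-1 * 'C(n + k - cdes w, n)%:R *
      (\prod_(1 <= i < n.+2) indet i ^+ ncycles i w) m by [].
  by rewrite E (prod_indetE _ (fun i => ncycles i w)); case: asboolP; rewrite ?mulr1 ?mulr0.
case: eqP => [mn|_] /=; last by rewrite big1.
rewrite -big_mkcond /= -mulr_sumr -natr_sum.
have mE : (\sum_(1 <= i < n.+2) i * m i.-1)%N = n.+1.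
  by rewrite -weightE // => j nj; apply: weight_bound; rewrite mn.
have := @cyclic_descent_cycle_type n.+1 k (fun i => m i.-1) M isT k_ge2 mE.
move=> /(_ (fun i iN => ME (proj1 (andP iN)))).
rewrite (eq_bigr (fun w : 'S_n.+1 => 'C(n + k - cdes w, n))); last first.
  by move=> w _; rewrite addSn !subn1.
move=> /(congr1 (fun x => x%:R : rat)); rewrite !natrM natrB; last by lia.
rewrite /necklace_series /necklace_multisets mn.
move: (\sum_(_ | _) _)%N (\prod_(_ <= _ < _) _)%N => S Q SQ.
have n0 : (n.+1%:R : rat) != 0 by rewrite pnatr_eq0.
apply: (mulfI k1_neq0); rewrite mulrCA SQ mulVKf //.
by rewrite invfM mulrACA mulVf // mul1r mulrC.
Qed.

(** The correction terms on the right only concern weights [0] and [1], which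
    the sum over [n >= 1] does not reach. *)
Lemma cycle_series_lim :
  fps_lim
    (fun N => 1 + \sum_(1 <= n < N.+1) \sum_(w : 'S_n.+1)
       ((n.+1%:R * k%:R ^+ n.+1)^-1 * 'C(n + k - cdes w, n)%N%:R) *:
         \prod_(1 <= i < n.+2) indet i ^+ ncycles i w)
    (1 - ((k%:R - 1)^-1)%:A - k%:R^-1 *: indet 1 + (k%:R - 1)^-1 *: necklace_series).
Proof.
move=> d; exists d => N m dN md.
have addE (f g : fps) : (f + g) m = f m + g m by [].
have rhsE (a b c : rat) (f g h : fps) :
  (1 - a *: f - b *: g + c *: h) m = (1 : fps) m - a * f m - b * g m + c * h m by [].
have indetE : indet 1 m = (m == [mset 0%N]%mset)%:R := erefl.
have oneE : (1 : fps) m = (m == mset0)%:R := erefl.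
rewrite addE rhsE oneE indetE fps_sumE.
under eq_bigr => n _ do rewrite cycle_series_coef.
have w0 : (m == mset0) = (d == 0%N).
  apply/eqP/eqP => [m0|d0].
    by rewrite -md /weight m0 big1 // => j _; rewrite mset0E muln0.
  by apply/msetP => j; rewrite mset0E; apply: weight_bound; rewrite md d0.
have w1 : (m == [mset 0%N]%mset) = (d == 1%N).
  apply/eqP/eqP => [m1|d1].
    rewrite -md (@weightE m 1) => [|j j1]; last by rewrite m1 msetnE gtn_eqF.
    by rewrite big_nat1 m1 msetnxx.
  apply/msetP => j; rewrite msetnE; case: eqP => [->|/eqP j0].
    have := @weightE m 1; rewrite md d1 big_nat1 mul1n => <- // l l1.
    by apply: weight_bound; rewrite md d1.
  by apply: weight_bound; rewrite md d1 lt0n.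
rewrite w0 w1; case: d dN md w0 w1 => [|[|n]] nN mn w0 w1 /=.
- rewrite big1 => [|n _]; last by rewrite mn.
  rewrite /necklace_series /necklace_multisets mn big_geq // invr1 !mulr1 mulr0.
  by rewrite addr0 subr0; apply/esym/subrK.
- rewrite big_nat big1 => [|n /andP[n0 _]]; last by rewrite mn eqSS ltn_eqF.
  have m0 : m 0%N = 1%N by move: w1; rewrite eqxx => /eqP->; rewrite msetnxx.
  have M1 : (M 1%N)%:R = k%:R - 1 :> rat.
    by rewrite ME // (_ : divisors 1 = [:: 1%N]) // big_seq1 divn1 invr1 !mul1r expr1.
  rewrite /necklace_series /necklace_multisets mn big_nat1 m0 addnK bin1 M1 expr1.
  by rewrite mulKf // mulr1 !mulr0 oppr0 !add0r addNr.
rewrite (bigD1_seq n.+1) ?iota_uniq //=; last by rewrite mem_index_iota /= leqW.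
rewrite mn eqxx.
rewrite big1 => [|i /negPf ni]; last by rewrite eqSS eq_sym ni.
by rewrite !mulr0 !oppr0 addr0 !add0r.
Qed.

End GeneratingFunction.

(** * Factorization of monic polynomials *)

Section MonicPolynomials.
Variable F : finFieldType.
Implicit Types (p q h : {poly F}).

Lemma monic_eqp p q : p \is monic -> q \is monic -> p %= q -> p = q.
Proof.
move=> pm qm /eqp_eq; rewrite (monicP pm) (monicP qm) !scale1r.
by move=> ->.
Qed.

(** A reducible polynomial has a divisor of intermediate degree, which can be
    made monic; the cofactor is then monic too. *)
Lemma monic_factorization h : h \is monic ->
  exists s : seq {poly F},
    (forall p, p \in s -> p \is monic /\ irreducible_poly p) /\ h = \prod_(p <- s) p.
Proof.
elim: {h}(size h) {-2}h (leqnn (size h)) => [|n IH] h hn hm.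
  by move: hn; rewrite leqn0 size_poly_eq0 (negPf (monic_neq0 hm)).
have [h1|h1] := eqVneq (size h) 1%N.
  exists [::]; split=> //; rewrite big_nil; have /eqP/size_poly1P[c _ hc] := h1.
  by move: hm; rewrite hc monicE lead_coefC => /eqP->.
have [hi|hni] := pselect (irreducible_poly h).
  by exists [:: h]; rewrite big_seq1; split=> // p; rewrite inE => /eqP->.
have h_gt1 : (1 < size h)%N.
  by rewrite ltn_neqAle eq_sym h1 size_poly_gt0 monic_neq0.
have [d [d1 [dh dnh]]] : exists d : {poly F}, size d != 1%N /\ (d %| h /\ ~~ (d %= h)).
  apply: contrapT => nex; apply: hni; split=> // d d1 dh.
  by apply/negPn/negP => dnh; apply: nex; exists d.
have d0 : d != 0 by apply: contraTneq dh => ->; rewrite dvd0p monic_neq0.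
pose d' := (lead_coef d)^-1 *: d.
have ld : lead_coef d != 0 by rewrite lead_coef_eq0.
have d'm : d' \is monic by rewrite monicE lead_coefZ mulVf.
have d'd : d' %= d by rewrite eqp_scale // invr_eq0.
have [e he] : exists e, h = e * d'.
  by apply/dvdpP; rewrite (eqp_dvdl _ d'd).
have em : e \is monic by move: hm; rewrite he monicMr.
have sz : size h = (size e + size d').-1 by rewrite he size_monicM ?monic_neq0.
have sd' : size d' = size d by exact: eqp_size.
have d_gt1 : (1 < size d)%N by rewrite ltn_neqAle eq_sym d1 size_poly_gt0.
have d_lt : (size d < size h)%N.
  rewrite ltn_neqAle dvdp_leq ?monic_neq0 // andbT.
  by apply: contra dnh => /eqP sE; rewrite -dvdp_size_eqp // sE.
have e_pos : (0 < size e)%N by rewrite size_poly_gt0 monic_neq0.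
have le_e : (size e <= n)%N by move: sz; rewrite sd'; lia.
have le_d : (size d' <= n)%N by rewrite sd'; lia.
have [s1 [s1P es1]] := IH e le_e em; have [s2 [s2P es2]] := IH d' le_d d'm.
exists (s1 ++ s2); rewrite big_cat he es1 es2; split=> // p.
by rewrite mem_cat => /orP[/s1P|/s2P].
Qed.

Section Products.
Variables (N : nat) (Q : pred {poly_N.+1 F}).
Hypothesis Q_irr : forall p : {poly_N.+1 F}, Q p -> (p : {poly F}) \is monic /\ irreducible_poly (p : {poly F}).
Local Notation T := {poly_N.+1 F}.
Implicit Type f : {ffun T -> 'I_N.+1}.

Definition poly_prod f : {poly F} := \prod_(p | Q p) (p : {poly F}) ^+ f p.

Definition degree (p : T) : nat := (size (p : {poly F})).-1.

Lemma degree_bounds (p : T) : Q p -> (0 < degree p <= N)%N.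
Proof.
move=> /Q_irr[_ [sp _]]; have := size_npoly p; rewrite /degree => le.
by case: (size _) sp le => [|[]].
Qed.

Lemma poly_prod_monic f : poly_prod f \is monic.
Proof. by apply: monic_prod => p /Q_irr[pm _]; exact: monic_exp. Qed.

Lemma size_poly_prod f : size (poly_prod f) = (\sum_(p | Q p) degree p * f p)%N.+1.
Proof.
rewrite /poly_prod; set m := (\sum_(_ | _) _)%N.
suff : \prod_(p | Q p) (p : {poly F}) ^+ f p \is monic /\
       size (\prod_(p | Q p) (p : {poly F}) ^+ f p) = m.+1 by case.
apply: (big_ind2 (fun (h : {poly F}) d => h \is monic /\ size h = d.+1)).
- by rewrite monic1 size_poly1.
- move=> h d h' d' [hm hs] [h'm h's]; split; first by rewrite monicMl.
  by rewrite size_monicM ?monic_neq0 // hs h's addSn addnS.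
move=> p /Q_irr[pm _]; split; first exact: monic_exp.
by rewrite /degree -size_exp prednK // size_poly_gt0 expf_neq0 // monic_neq0.
Qed.

Lemma coprime_other_factors f (p : T) : Q p ->
  coprimep p (\prod_(r | Q r && (r != p)) (r : {poly F}) ^+ f r).
Proof.
move=> Qp; have [pm pirr] := Q_irr Qp.
apply: (big_ind (fun h : {poly F} => coprimep p h)); first exact: coprimep1.
  by move=> h h' ph ph'; rewrite coprimepMr ph.
move=> r /andP[/Q_irr[rm rirr] rp]; apply: coprimep_expr.
rewrite irreducible_poly_coprime //; apply: contra rp => pr; apply/eqP/val_inj.
apply/esym/monic_eqp => //; apply: rirr.2 => //.
by rewrite neq_ltn pirr.1 orbT.
Qed.

(** Unique factorization: if some [p] occurred more often on one side, then
    after cancellation it would divide the product of the other factors, to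
    which it is coprime. *)
Lemma poly_prod_inj (f g : {ffun T -> 'I_N.+1}) :
  (forall p : T, ~~ Q p -> f p = ord0) -> (forall p : T, ~~ Q p -> g p = ord0) ->
  poly_prod f = poly_prod g -> f = g.
Proof.
have lt_absurd (f' g' : {ffun T -> 'I_N.+1}) (p : T) : Q p -> (f' p < g' p)%N -> poly_prod f' <> poly_prod g'.
  move=> Qp lt; rewrite /poly_prod (bigD1 p) // [RHS](bigD1 p) //=.
  rewrite -(subnKC (ltnW lt)) exprD -mulrA => /mulfI-/(_ _)/wrap[].
    by rewrite expf_neq0 // monic_neq0 //; case: (Q_irr Qp).
  move=> e; have := coprime_other_factors f' Qp; rewrite e.
  rewrite irreducible_poly_coprime; last by case: (Q_irr Qp).
  move/negP; apply; apply: dvdp_mulr; rewrite -(subnSK lt) exprS.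
  exact: dvdp_mulIl.
move=> f0 g0 e; apply/ffunP => p; case: (boolP (Q p)) => Qp; last by rewrite f0 ?g0.
apply: val_inj; apply/eqP; rewrite eqn_leq; apply/andP; split; rewrite leqNgt; apply/negP => lt.
  exact: (lt_absurd g f p Qp lt).
exact: (lt_absurd f g p Qp lt).
Qed.

(** Passage from lists of factors to multiplicity functions. *)
Lemma exists_poly_prod (s : seq {poly F}) :
  (forall p, p \in s -> [/\ p \is monic, irreducible_poly p & (size p <= N.+1)%N
                         /\ Q (npolyp N.+1 p)]) ->
  (size s <= N)%N ->
  exists f : {ffun T -> 'I_N.+1}, [/\ forall p : T, ~~ Q p -> f p = ord0,
    poly_prod f = \prod_(p <- s) p &
    forall i, (\sum_(p | Q p && (degree p == i)) f p
              = count (fun p : {poly F} => size p == i.+1) s)%N].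
Proof.
move=> sP sN; exists [ffun p : T => if Q p then inord (count_mem (p : {poly F}) s) else ord0].
have fE (p : T) : Q p ->
    (inord (count_mem (p : {poly F}) s) : 'I_N.+1) = count_mem (p : {poly F}) s :> nat.
  by move=> Qp; rewrite inordK // ltnS (leq_trans (count_size _ _)).
split=> [p nQ| |i]; first by rewrite ffunE (negPf nQ).
  rewrite /poly_prod.
  transitivity (\prod_(p | Q p) (p : {poly F}) ^+ count_mem (p : {poly F}) s).
    by apply: eq_bigr => p Qp; rewrite ffunE Qp fE.
  elim: s sP {sN fE} => [|q s IH] sP.
    by rewrite big_nil big1.
  have [qm qi [qs Qq]] := sP q (mem_head _ _).
  rewrite big_cons -IH => [|p ps]; last by apply: sP; rewrite inE ps orbT.
  under eq_bigr => p _ do rewrite /= exprD.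
  rewrite big_split /=; congr (_ * _); rewrite (bigD1 (npolyp N.+1 q)) //=.
  rewrite npolypK // eqxx expr1 big1 ?mulr1 // => p /andP[Qp pq].
  case: eqP => [qp|]; last by rewrite expr0.
  by case/eqP: pq; apply: val_inj; rewrite /= qp npolypK // -qp.
transitivity (\sum_(p | Q p && (degree p == i)) count_mem (p : {poly F}) s)%N.
  by apply: eq_bigr => p /andP[Qp _]; rewrite ffunE Qp fE.
elim: s sP {sN fE} => [|q s IH] sP; first by rewrite big1.
have [qm qi [qs Qq]] := sP q (mem_head _ _).
rewrite /= -IH => [|p ps]; last by apply: sP; rewrite inE ps orbT.
rewrite big_split /=; congr (_ + _)%N.
have q0 : (0 < size q)%N by rewrite size_poly_gt0 monic_neq0.
have dq : degree (npolyp N.+1 q) = (size q).-1 by rewrite /degree npolypK.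
case: eqP => qi'.
  rewrite (bigD1 (npolyp N.+1 q)) /= ?Qq ?dq ?qi' ?eqxx // npolypK // eqxx big1 // => p.
  move=> /andP[_ pq]; case: eqP => // qp; case/eqP: pq.
  by apply: val_inj; rewrite /= qp npolypK // -qp.
rewrite big1 // => p /andP[_ /eqP dp]; case: eqP => // qp; case: qi'.
by rewrite -dp /degree -qp prednK.
Qed.

End Products.

End MonicPolynomials.

(** * Factorization types over a finite field *)

Section PolynomialCounts.
Variable F : finFieldType.
Local Notation k := #|F|.
Implicit Types (h : {poly F}).

(** The lower coefficients of a monic polynomial are free; [B] restricts each of
    them separately. *)
Lemma card_monic_coefs (n N : nat) (B : 'I_n -> pred F) : (n <= N)%N ->
  #|[set h : {poly_N.+1 F} | [&& (h : {poly F}) \is monic, size h == n.+1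
                               & [forall i : 'I_n, B i h`_i]]]|
  = (\prod_(i < n) #|B i|)%N.
Proof.
move=> nN.
pose h_of (c : {ffun 'I_n -> F}) : {poly F} := 'X^n + \poly_(i < n) (if insub i is Some j then c j else 0).
have h_size c : size (h_of c) = n.+1.
  by rewrite size_polyDl size_polyXn // ltnS size_poly.
have h_monic c : h_of c \is monic.
  by rewrite monicE lead_coefDl ?lead_coefXn // size_polyXn ltnS size_poly.
have h_coef c (i : 'I_n) : (h_of c)`_i = c i.
  by rewrite coefD coefXn coef_poly ltn_ord ltn_eqF // add0r valK.
transitivity #|family B|; last by rewrite card_family foldrE big_image.
rewrite -(card_imset _ (f := fun c => npolyp N.+1 (h_of c))); last first.
  move=> c c' e; apply/ffunP => i; rewrite -!h_coef.
  have := congr1 (fun p : {poly_N.+1 F} => (p : {poly F})`_i) e.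
  by rewrite /= !npolypK ?h_size.
apply: eq_card => h; rewrite inE; apply/and3P/imsetP => [[hm /eqP hs /forallP hB]|[c cB ->]].
  exists [ffun i : 'I_n => h`_i]; first by apply/familyP => i; rewrite ffunE; exact: hB.
  apply: val_inj; rewrite /= npolypK ?h_size //; apply/polyP => i.
  rewrite coefD coefXn coef_poly; case: ltngtP => ni.
  - by case: insubP => [j _ <-|]; rewrite ?ni // ffunE add0r.
  - by rewrite addr0 nth_default // hs.
  - by rewrite addr0 ni; move/monicP: hm; rewrite lead_coefE hs.
rewrite npolypK ?h_size //; split=> //.
by apply/forallP => i; rewrite h_coef; exact: (familyP cB).
Qed.

Lemma card_monic (n N : nat) : (n <= N)%N ->
  #|[set h : {poly_N.+1 F} | ((h : {poly F}) \is monic) && (size h == n.+1)]| = (k ^ n)%N.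
Proof.
move=> nN; transitivity (\prod_(i < n) #|(fun=> xpredT : pred F) i|)%N; last first.
  by rewrite prod_nat_const card_ord; congr (_ ^ _)%N; apply: eq_card.
rewrite -(card_monic_coefs (fun=> xpredT) nN); apply: eq_card => h; rewrite !inE.
by case: forallP => [_|[]//]; rewrite andbT.
Qed.

Lemma card_monic_nz_polys (n : nat) : (0 < n)%N ->
  #|monic_nz_polys F n| = ((k - 1) * k ^ (n - 1))%N.
Proof.
case: n => [//|n] _.
transitivity (\prod_(i < n.+1) #|[pred a : F | (i == ord0) ==> (a != 0%R)]|)%N.
  rewrite -(@card_monic_coefs _ n.+1) //; apply: eq_card => h; rewrite !inE.
  do 2!congr (_ && _); apply/idP/forallP => [h0 i|/(_ ord0)//].
  by apply/implyP => /eqP->.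
rewrite big_ord_recl /= (eq_bigr (fun=> k)) => [|i _]; last exact: eq_card.
rewrite prod_nat_const card_ord !subn1 /=; congr (_ * _)%N.
have -> : #|[pred a : F | (ord0 == ord0 :> 'I_n.+1) ==> (a != 0)]| = #|predC1 (0 : F)|.
  by apply: eq_card.
by rewrite cardC1.
Qed.

Variable N : nat.
Local Notation T := {poly_N.+1 F}.

Definition monic_irreducible : pred T :=
  fun p => ((p : {poly F}) \is monic) && `[< irreducible_poly (p : {poly F}) >].

Definition monic_irreducible_nz : pred T := fun p => monic_irreducible p && (p`_0 != 0).

Lemma monic_irreducibleP (p : T) : monic_irreducible p ->
  (p : {poly F}) \is monic /\ irreducible_poly (p : {poly F}).
Proof. by move=> /andP[pm /asboolP]. Qed.

Lemma monic_irreducible_nzP (p : T) : monic_irreducible_nz p ->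
  (p : {poly F}) \is monic /\ irreducible_poly (p : {poly F}).
Proof. by move=> /andP[/monic_irreducibleP]. Qed.

Lemma monic_irreducible_npolyp (p : {poly F}) : p \is monic -> irreducible_poly p ->
  (size p <= N.+1)%N -> monic_irreducible (npolyp N.+1 p).
Proof. by move=> pm pi ps; rewrite /monic_irreducible npolypK // pm; apply/asboolP. Qed.

Lemma size_factors_le (s : seq {poly F}) :
  (forall p, p \in s -> p \is monic /\ irreducible_poly p) ->
  (forall p, p \in s -> size p <= size (\prod_(p <- s) p)%R)%N
  /\ (size s < size (\prod_(p <- s) p)%R)%N.
Proof.
elim: s => [|q s IH] sP; first by rewrite big_nil size_poly1; split.
have [qm [q1 _]] := sP q (mem_head _ _).
have [p ps|IHp IHs] := IH; first by apply: sP; rewrite inE ps orbT.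
have sm : \prod_(p <- s) p \is monic.
  by rewrite big_seq; apply: monic_prod => p ps; case: (sP p _); rewrite // inE ps orbT.
rewrite big_cons size_monicM ?monic_neq0 //.
move: IHp IHs; set a := size _ => IHp IHs; set b := size q in q1 *.
split=> [p|]; last by rewrite /=; move: IHs q1; move: (size s) (a) (b) => l x y; lia.
rewrite inE => /orP[/eqP->|/IHp]; rewrite -/b; last by move: (size p) => l; lia.
by move: IHs => /(leq_trans (ltn0Sn _)); lia.
Qed.

Lemma multiset_of_factors (Q : pred T) (s : seq {poly F}) :
  (forall p, p \in s -> [/\ p \is monic, irreducible_poly p & Q (npolyp N.+1 p)]) ->
  (size (\prod_(p <- s) p)%R <= N.+1)%N ->
  exists f : {ffun T -> 'I_N.+1}, [/\ forall p : T, ~~ Q p -> f p = ord0,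
    poly_prod Q f = \prod_(p <- s) p &
    forall i, (\sum_(p | Q p && (degree p == i)) f p
              = count (fun p : {poly F} => size p == i.+1) s)%N].
Proof.
move=> sP sN; have [|le_p le_s] := @size_factors_le s; first by move=> p /sP[].
apply: exists_poly_prod; last by rewrite -ltnS (leq_trans le_s).
by move=> p ps; have [pm pi Qp] := sP p ps; split=> //; split=> //; exact: leq_trans (le_p p ps) sN.
Qed.

Lemma card_multisets_irreducible n : (n <= N)%N ->
  #|multisets N monic_irreducible (@degree F N) n| = (k ^ n)%N.
Proof.
move=> nN; rewrite -(card_monic nN).
have sz f : f \in multisets N monic_irreducible (@degree F N) n ->
    size (poly_prod monic_irreducible f) = n.+1.
  by move=> /multisetsP[_ fn]; rewrite (size_poly_prod monic_irreducibleP) fn.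
rewrite -(card_in_imset (f := fun f => npolyp N.+1 (poly_prod monic_irreducible f))).
  apply: eq_card => h; rewrite [RHS]inE; apply/imsetP/andP => [[f fm ->]|[hm /eqP hs]].
    by rewrite npolypK sz // (poly_prod_monic monic_irreducibleP).
  have [s [sP hE]] := monic_factorization hm.
  have [p ps||f [f0 fE _]] := @multiset_of_factors monic_irreducible s.
  - have [pm pi] := sP p ps; split=> //; apply: monic_irreducible_npolyp => //.
    have [le_p _] := size_factors_le sP; apply: leq_trans (le_p p ps) _.
    by rewrite -hE hs.
  - by rewrite -hE hs.
  exists f; last by apply: val_inj; rewrite /= fE -hE npolypK // hs.
  apply/multisetsP; split=> //; apply: succn_inj.
  by rewrite -(size_poly_prod monic_irreducibleP) fE -hE.
move=> f g fm gm e; case/multisetsP: (fm) => f0 _; case/multisetsP: (gm) => g0 _.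
apply: (poly_prod_inj monic_irreducibleP f0 g0).
have := congr1 (fun p : T => (p : {poly F})) e.
by rewrite /= !npolypK ?sz.
Qed.

(** The irreducible polynomials are counted by unique factorization alone: the
    number [k^n] of monic polynomials of degree [n] determines the power sums,
    hence the number of irreducibles of each degree. The only monic irreducible
    polynomial that vanishes at [0] is ['X], whose removal accounts for the
    [- 1] in the sum. *)
Lemma card_irreducible_nz i : (0 < i <= N)%N ->
  #|[pred p | monic_irreducible_nz p & degree p == i]|%:R
  = i%:R^-1 * \sum_(d <- divisors i) (moebius d)%:~R * (k%:R ^+ (i %/ d) - 1) :> rat.
Proof.
move=> iN; have i0 : (0 < i)%N by case/andP: iN.
have deg_gt0 (p : T) : monic_irreducible p -> (0 < degree p)%N.
  by move=> /(degree_bounds monic_irreducibleP)/andP[].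
have k0 : (0 < k)%N by apply/card_gt0P; exists 0.
have wk := weight_divisor_sum_exp deg_gt0 k0 card_multisets_irreducible.
have cE := weight_count_moebius deg_gt0 wk iN.
under eq_bigr => d _ do rewrite mulrBr mulr1.
rewrite sumrB -rmorph_sum /= sum_moebius // mulrBr -cE.
suff -> : #|[pred p | monic_irreducible p & degree p == i]|
    = (#|[pred p | monic_irreducible_nz p & degree p == i]| + (i == 1))%N.
  by rewrite natrD; case: eqP => [->|_]; rewrite ?mulr0 ?addr0 ?subr0 // invr1 mul1r addrK.
rewrite -(cardID [pred p : T | p`_0 != 0]); congr (_ + _)%N.
  by apply: eq_card => p; rewrite !inE /monic_irreducible_nz andbAC.
have N1 : (2 <= N.+1)%N by rewrite ltnS (leq_trans i0) //; case/andP: iN.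
have sX : size ('X : {poly F}) = 2%N by rewrite size_polyX.
have isX (p : T) : monic_irreducible p -> p`_0 = 0 -> p = 'X :> {poly F}.
  move=> /monic_irreducibleP[pm pi] p0; apply/esym/monic_eqp => //; first exact: monicX.
  apply: pi.2; first by rewrite sX.
  by rewrite -['X]subr0 -polyC0 dvdp_XsubCl rootE horner_coef0 p0.
have X_irr : monic_irreducible (npolyp N.+1 'X).
  apply: monic_irreducible_npolyp; rewrite ?monicX ?sX //.
  by rewrite -['X]subr0 -polyC0; exact: irredp_XsubC.
case: eqP => [->|i1].
  transitivity #|pred1 (npolyp N.+1 'X : T)|; last by rewrite card1.
  apply: eq_card => p; rewrite !inE negbK.
  apply/and3P/eqP => [[/eqP p0 pi _]|->].
    by apply: val_inj; rewrite /= npolypK ?sX // isX.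
  by rewrite X_irr /degree npolypK ?sX // coefX.
apply: eq_card0 => p; rewrite !inE negbK; apply/and3P => -[/eqP p0 pi /eqP dp].
by case: i1; rewrite -dp /degree isX // sX.
Qed.

End PolynomialCounts.

(** By unique factorization, the polynomials with factorization type [c] are
    the multisets of type [c] of irreducibles other than ['X]. *)
Lemma card_factors_as (F : finFieldType) (n : nat) (c : nat -> nat) :
  (\sum_(1 <= i < n.+1) i * c i)%N = n -> (forall i, (n < i)%N -> c i = 0%N) ->
  #|[set p in monic_nz_polys F n | `[< factors_as c (p : {poly F}) >]]|
  = (\prod_(1 <= i < n.+1)
      'C(#|[pred p | @monic_irreducible_nz F n p & degree p == i]| + c i - 1, c i))%N.
Proof.
move=> cn c0; pose Q := @monic_irreducible_nz F n.
have QP : forall p : {poly_n.+1 F}, Q p -> (p : {poly F}) \is monic /\ irreducible_poly (p : {poly F}).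
  exact: monic_irreducible_nzP.
have deg_le := degree_bounds QP.
have c_le := multiplicity_le cn.
rewrite -(card_typed_multisets deg_le c_le).
have tyP f : f \in typed_multisets n Q (@degree F n) c ->
    (forall p, ~~ Q p -> f p = ord0) /\ size (poly_prod Q f) = n.+1.
  move=> fT; have /multisetsP[f0 fs] := subsetP (typed_multisets_sub deg_le cn) f fT.
  by split=> //; rewrite (size_poly_prod QP) fs.
rewrite -[RHS](card_in_imset (f := fun f => npolyp n.+1 (poly_prod Q f))); last first.
  move=> f g /tyP[f0 fs] /tyP[g0 gs] e; apply: (poly_prod_inj QP f0 g0).
  have := congr1 (fun p : {poly_n.+1 F} => (p : {poly F})) e.
  by rewrite /= !npolypK ?fs ?gs.
apply: eq_card => h; apply/setIdP/imsetP => [[]|[f fT ->]].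
  rewrite inE => /and3P[hm /eqP hs h0] /asboolP[s [sP hE sc]].
  have [le_p _] := size_factors_le sP.
  have [p ps||f [f0 fE ft]] := @multiset_of_factors F n Q s.
  - have [pm pi] := sP p ps; have sp : (size p <= n.+1)%N.
      by rewrite -hs hE; exact: le_p.
    split=> //; rewrite /Q /monic_irreducible_nz monic_irreducible_npolyp //=.
    rewrite npolypK //; apply: contraNneq h0 => p0; rewrite hE -horner_coef0.
    by rewrite (big_rem p) //= hornerM horner_coef0 p0 mul0r.
  - by rewrite -hE hs.
  exists f; last by apply: val_inj; rewrite /= fE -hE npolypK // hs.
  by apply/typed_multisetsP; split=> // i /andP[i0 _]; rewrite ft sc.
have [f0 fs] := tyP f fT; have [_ ft] := elimT (typed_multisetsP _ _ _ _) fT.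
rewrite inE npolypK ?fs // eqxx (poly_prod_monic QP) /=; split.
  rewrite -horner_coef0 /poly_prod horner_prod prodf_seq_neq0; apply/allP => p _.
  apply/implyP => /andP[_ p0]; rewrite horner_exp.
  by rewrite expf_neq0 // horner_coef0.
apply/asboolP; exists (flatten [seq nseq (f p) (p : {poly F}) | p <- enum Q]); split.
- move=> q /flattenP[_ /mapP[p + ->]]; rewrite mem_enum => Qp /nseqP[-> _].
  exact: QP.
- rewrite big_flatten big_map big_enum /=; apply: eq_big => // p _.
  by rewrite big_nseq iter_mulr_1.
move=> i i0; rewrite count_flatten -map_comp sumnE big_map big_enum /=.
transitivity (\sum_(p | Q p && (degree p == i)) f p)%N.
  rewrite [RHS]big_mkcondr /=; apply: eq_big => // p Qp; rewrite /= count_nseq.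
  have := deg_le p Qp; rewrite /degree; case: (size _) => [|d] //= _.
  by rewrite eqSS; case: eqP; rewrite ?mul1n.
case: (leqP i n) => iN; first by rewrite ft // i0.
rewrite c0 // big1 // => p /andP[Qp /eqP dp].
by have := deg_le p Qp; rewrite dp [(i <= n)%N]leqNgt iN andbF.
Qed.

(** * The two halves together *)

Theorem theorem5 (k : nat) (hk : (2 <= k)%N) :
  (exists P : fps,
     fps_lim
       (fun N => \prod_(1 <= i < N.+1)
          fps_powr (1 - (k%:R ^+ i)^-1 *: indet i)
            (- ((i%:R)^-1 * \sum_(d <- divisors i)
                  (moebius d)%:~R * (k%:R ^+ (i %/ d)%N - 1))))
       P /\
     fps_lim
       (fun N => 1 + \sum_(1 <= n < N.+1) \sum_(w : 'S_n.+1)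
          ((n.+1%:R * k%:R ^+ n.+1)^-1 * 'C(n + k - cdes w, n)%N%:R) *:
            \prod_(1 <= i < n.+2) indet i ^+ ncycles i w)
       (1 - ((k%:R - 1)^-1)%:A - k%:R^-1 *: indet 1 + (k%:R - 1)^-1 *: P)) /\
  (forall F : finFieldType, #|F| = k ->
   forall (n : nat) (c : nat -> nat), (1 <= n)%N ->
     (forall i, (n < i)%N -> c i = 0%N) ->
     (\sum_(1 <= i < n.+1) i * c i)%N = n ->
     \sum_(w : 'S_n | `[< forall i, (1 <= i)%N -> ncycles i w = c i >])
        riffle_cut_prob k w
     = #|[set p in monic_nz_polys F n | `[< factors_as c (p : {poly F}) >]]|%:R
       / #|monic_nz_polys F n|%:R).
Proof.
split=> [|F Fk n c n0 c0 cn].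
  have [M ME] := necklace_number_exists (ltnW hk).
  exists (necklace_series k M).
  by split; [exact: euler_product_lim | exact: cycle_series_lim].
rewrite (card_factors_as F cn c0) card_monic_nz_polys // Fk.
set M := fun i => #|[pred p | @monic_irreducible_nz F n p & degree p == i]|.
have ME i : (0 < i <= n)%N -> (M i)%:R =
     i%:R^-1 * \sum_(d <- divisors i) (moebius d)%:~R * (k%:R ^+ (i %/ d) - 1) :> rat.
  by rewrite -Fk; exact: card_irreducible_nz.
have main := cyclic_descent_cycle_type n0 hk cn ME.
transitivity ((n%:R * k%:R ^+ (n - 1))^-1 *
    (\sum_(w : 'S_n | has_cycle_type c w) 'C(n + k - 1 - cdes w, n - 1))%N%:R : rat).
  rewrite natr_sum mulr_sumr (reindex_inj invg_inj) /=; apply: eq_big => w.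
    apply/asboolP/has_cycle_typeP => h i.
      by move=> /andP[i0 _]; rewrite -ncyclesV h.
    move=> i0; rewrite ncyclesV; case: (leqP i n) => iN; first by rewrite h ?i0.
    by rewrite ncycles_gt // c0.
  by move=> _; rewrite /riffle_cut_prob invgK subnAC.
move: (\sum_(_ | _) _)%N (\prod_(_ <= _ < _) _)%N main => S Q main.
have n_neq0 : (n%:R : rat) != 0 by rewrite pnatr_eq0 -lt0n.
have k1_neq0 : ((k - 1)%N%:R : rat) != 0 by rewrite pnatr_eq0 -lt0n subn_gt0.
have SQ : (k - 1)%N%:R * S%:R = n%:R * Q%:R :> rat by rewrite -!natrM main.
have k_neq0 : ((k : nat)%:R : rat) != 0 by rewrite pnatr_eq0 -lt0n ltnW.
have -> : S%:R = (k - 1)%N%:R^-1 * (n%:R * Q%:R) :> rat by rewrite -SQ mulKf.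
rewrite natrM natrX; have := expf_neq0 (n - 1) k_neq0.
move: (k%:R ^+ _) (k - 1)%N%:R n%:R k1_neq0 n_neq0 => K K1 nn K1n nn0 K0.
by field; rewrite K0 K1n nn0.
Qed.
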